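(* Let $a\ge 1$ and define $$h_a(x)=\frac{e^{-ax}\big[ax-1+e^{-x}\big(1-(a-1)x\big)\big]}{(1-e^{-x})^2},\quad x>0.$$ Then $h_a$ is a probability density function on $(0,\infty)$, and for all $s\in\mathbb{C}$ with $\mathrm{Re}(s)>0$, $$\int_0^\infty x^{s-1}h_a(x)\,dx=(s-1)\Gamma(s)\zeta(s,a).$$
   Context: $\zeta(s,a)$ is the Hurwitz zeta function, defined by $\zeta(s,a)=\sum_{n=0}^\infty(n+a)^{-s}$ for $\mathrm{Re}(s)>1$, $a>0$, and by analytic continuation for $s\neq1$, with a simple pole of residue $1$ at $s=1$. The right-hand side of the identity is interpreted by continuity at $s=1$. *)

(* Defs.v *)
From Stdlib Require Import Reals.
From Coquelicot Require Import Coquelicot.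

Local Open Scope R_scope.

(* [x^z] for a real base [x > 0], that is [exp (z * ln x)]. *)
Definition Rcpow (x : R) (z : C) : C :=
  (exp (Re z * ln x) * cos (Im z * ln x),
   exp (Re z * ln x) * sin (Im z * ln x)).

(* Integrals over (0, +oo) are improper at both ends. *)
Definition is_RInt_pos {V : NormedModule R_AbsRing} (f : R -> V) (l : V) : Prop :=
  is_RInt_gen f (at_right 0) (Rbar_locally p_infty) l.

(* Euler's integral: this is the Gamma function on the half-plane [0 < Re s];
   the value is meaningless elsewhere. *)
Definition Gamma (s : C) : C :=
  RInt_gen (V := C_R_CompleteNormedModule)
    (fun x : R => (Rcpow x (s - 1) * exp (- x))%C)
    (at_right 0) (Rbar_locally p_infty).

Definition analytic_at (f : C -> C) (z0 : C) : Prop :=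
  exists (c : nat -> C) (r : posreal),
    forall z : C, Cmod (z - z0)%C < r ->
      is_pseries (K := C_AbsRing) (V := C_NormedModule) c (z - z0)%C (f z).

(* [Z] continues the Dirichlet series of [zeta(., a)] analytically to the
   half-plane [sigma < Re z] with the point 1 removed. *)
Definition hurwitz_continuation (a sigma : R) (Z : C -> C) : Prop :=
  (forall z : C, sigma < Re z -> z <> RtoC 1 -> analytic_at Z z) /\
  (forall z : C, 1 < Re z ->
     is_series (K := C_AbsRing) (V := C_NormedModule)
       (fun n : nat => Rcpow (INR n + a) (- z)%C) (Z z)).

(* The value at [s <> 1] of the analytic continuation.  Punctured half-planes
   are connected and nested, so this value depends neither on [sigma] nor on
   [Z], and letting [sigma] tend to -oo covers the plane minus 1.  At the pole
   [s = 1] it is meaningless. *)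
Definition hurwitz_zeta (s : C) (a : R) : C :=
  iota (T := C_CompleteNormedModule) (fun w : C =>
    exists (sigma : R) (Z : C -> C),
      sigma < Re s /\ hurwitz_continuation a sigma Z /\ w = Z s).

Definition h (a x : R) : R :=
  exp (- a * x) * (a * x - 1 + exp (- x) * (1 - (a - 1) * x))
  / (1 - exp (- x)) ^ 2.

(* For a nonnegative function the improper Riemann integral agrees with the
   Lebesgue integral, and its existence includes Riemann integrability on
   every compact subinterval, hence measurability. *)
Definition is_density_pos (f : R -> R) : Prop :=
  (forall x : R, 0 < x -> 0 <= f x) /\ is_RInt_pos (V := R_NormedModule) f 1.

(* [w] is the value at [s] of [f], where [f] is not used at [p] itself but is
   extended to [p] by continuity. *)
Definition is_value_ext (f : C -> C) (p s w : C) : Prop :=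
  (s <> p -> w = f s) /\ (s = p -> filterlim f (locally' p) (locally w)).

(* Main.v *)
Require Import Defs.
From Stdlib Require Import Reals Lra Lia Factorial IndefiniteDescription.
From Coquelicot Require Import Coquelicot.

(** Write [u_a(x) = x exp(-a x) / (1 - exp(-x))].  Then [h a = - u_a'], with
    [u_a] tending to 1 at 0 and to 0 at infinity, so [h a] has integral 1
    ([h_density]).

    The geometric series gives [h_a(x) = (a x - 1) exp(-a x) + h_(a+1)(x)], and
    [x^(s-1) (b x - 1) exp(-b x)] has integral [(s - 1) Gamma(s) b^(-s)] by
    parts.  As [|h_b(x) - b exp(-b x)| <= (1 + b x) exp(-b x)], the Mellin
    transform of [h_b] is [Gamma(s) b^(1-s)] up to [O(b^(-Re s))].  Hence, on the
    whole half-plane [0 < Re s], the Mellin transform of [h a] is [Gamma(s)]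
    times the limit [L(s)] of
    [(s - 1) sum_(n < N) (n + a)^(-s) + (N + a)^(1-s)] ([mellin_h]).

    It remains to see that [L(s) = (s - 1) zeta(s, a)] where [zeta] is the
    analytic continuation.  For [1 < Re s] this is clear since [(N + a)^(1-s)]
    tends to 0.  For the analyticity of [L], the increments of the sequence
    above are expanded in power series whose majorants are summable: functions
    given by a power series with [sum |c_k| r^k <= M] are closed under sums,
    products, exponentials and normally convergent series, with explicit bounds
    ([power_sum], [zeta_reg_continuation]).  Every other continuation has the
    same value, by the identity theorem along a segment that avoids the pole
    ([hurwitz_continuation_unique]).  At [s = 1] the value by continuity is
    found from the continuity of the Mellin transform
    ([mellin_h_lipschitz_at_1]). *)

Local Open Scope R_scope.

Local Notation is_Cseries := (is_series (K := C_AbsRing) (V := C_NormedModule)).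
Local Notation Csum :=
  (@sum_n (NormedModule.AbelianMonoid C_AbsRing C_NormedModule)).

(** * Complex series *)

Lemma is_Cseries_iff (u : nat -> C) (l : C) :
  is_Cseries u l <->
  forall eps, 0 < eps ->
    exists N, forall n, (N <= n)%nat -> Cmod (Csum u n - l) < eps.
Proof.
unfold is_series.
rewrite (filterlim_locally_ball_norm (K := C_AbsRing) (U := C_NormedModule)); split.
- intros H eps He; exact (H (mkposreal eps He)).
- intros H eps; exact (H eps (cond_pos eps)).
Qed.

Lemma Cmod_minus_sym (x y : C) : Cmod (x - y) = Cmod (y - x).
Proof. rewrite <- Cmod_opp; f_equal; ring. Qed.

Lemma Cmod_le_0 (z : C) : (forall eps, 0 < eps -> Cmod z <= eps) -> z = 0.
Proof.
intros H; apply Cmod_eq_0.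
destruct (Rle_lt_or_eq_dec 0 (Cmod z) (Cmod_ge_0 z)) as [Hz | Hz]; [| now symmetry].
specialize (H (Cmod z / 2)); lra.
Qed.

Lemma is_Cseries_inj (u : nat -> C) (l l' : C) :
  is_Cseries u l -> is_Cseries u l' -> l = l'.
Proof.
rewrite !is_Cseries_iff; intros H H'.
enough (l - l' = 0)%C as E
  by (replace l with (l - l' + l')%C by ring; rewrite E; ring).
apply Cmod_le_0; intros eps He.
destruct (H (eps / 2)) as [N HN]; [lra |].
destruct (H' (eps / 2)) as [N' HN']; [lra |].
specialize (HN (max N N') ltac:(lia)); specialize (HN' (max N N') ltac:(lia)).
replace (l - l')%C with
  (- (Csum u (max N N') - l) + (Csum u (max N N') - l'))%C by ring.
eapply Rle_trans; [apply Cmod_triangle |]; rewrite Cmod_opp; lra.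
Qed.

Lemma sum_n_mono (u v : nat -> R) (n : nat) :
  (forall k, u k <= v k) -> sum_n u n <= sum_n v n.
Proof.
intros H; induction n as [| n IH]; rewrite ?sum_O, ?sum_Sn; [apply H |].
apply Rplus_le_compat; auto.
Qed.

Lemma Csum_norm_le (u : nat -> C) (M : nat -> R) (n : nat) :
  (forall k, Cmod (u k) <= M k) -> Cmod (Csum u n) <= sum_n M n.
Proof.
intros H; apply Rle_trans with (sum_n (fun k => Cmod (u k)) n).
- exact (norm_sum_n_m (V := C_NormedModule) u 0 n).
- now apply sum_n_mono.
Qed.

Lemma Csum_norm_diff_le (u : nat -> C) (M : nat -> R) (n p : nat) :
  (forall k, Cmod (u k) <= M k) -> (n <= p)%nat ->
  Cmod (Csum u p - Csum u n) <= sum_n M p - sum_n M n.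
Proof.
intros H; induction 1 as [| p Hp IH].
- replace (Csum u n - Csum u n)%C with (RtoC 0) by ring; rewrite Cmod_0; lra.
- rewrite !sum_Sn.
  change (Cmod (Csum u p + u (S p) - Csum u n) <= sum_n M p + M (S p) - sum_n M n).
  replace (Csum u p + u (S p) - Csum u n)%C
    with ((Csum u p - Csum u n) + u (S p))%C by ring.
  eapply Rle_trans; [apply Cmod_triangle |]; specialize (H (S p)); lra.
Qed.

Lemma sum_n_le_series (M : nat -> R) (m : R) (n : nat) :
  (forall k, 0 <= M k) -> is_series M m -> sum_n M n <= m.
Proof.
intros H0 HM; apply (is_lim_seq_incr_compare (sum_n M) m); [exact HM |].
intros k; rewrite sum_Sn; change (sum_n M k <= sum_n M k + M (S k)).
specialize (H0 (S k)); lra.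
Qed.

Lemma Cseries_tail_le (u : nat -> C) (l : C) (M : nat -> R) (m : R) (n : nat) :
  (forall k, Cmod (u k) <= M k) -> is_series M m -> is_Cseries u l ->
  Cmod (l - Csum u n) <= m - sum_n M n.
Proof.
intros H HM Hu; apply Rle_plus_epsilon; intros eps He.
rewrite is_Cseries_iff in Hu; destruct (Hu eps He) as [N HN].
set (p := max N n); specialize (HN p ltac:(lia)).
assert (Hp := Csum_norm_diff_le u M n p H ltac:(lia)).
assert (Hm : sum_n M p <= m).
{ apply sum_n_le_series; [| exact HM].
  intros k; eapply Rle_trans; [apply Cmod_ge_0 | apply H]. }
replace (l - Csum u n)%C with (- (Csum u p - l) + (Csum u p - Csum u n))%C by ring.
eapply Rle_trans; [apply Cmod_triangle |]; rewrite Cmod_opp; lra.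
Qed.

Lemma Cseries_norm_le (u : nat -> C) (l : C) (M : nat -> R) (m : R) :
  (forall k, Cmod (u k) <= M k) -> is_series M m -> is_Cseries u l ->
  Cmod l <= m.
Proof.
intros H HM Hu.
assert (Ht := Cseries_tail_le u l M m 0 H HM Hu); rewrite !sum_O in Ht.
replace l with ((l - u 0%nat) + u 0%nat)%C by ring.
eapply Rle_trans; [apply Cmod_triangle |]; specialize (H 0%nat); lra.
Qed.

Lemma ex_Cseries_le (u : nat -> C) (M : nat -> R) :
  (forall k, Cmod (u k) <= M k) -> ex_series M -> exists l, is_Cseries u l.
Proof. exact (ex_series_le (V := C_CompleteNormedModule) u M). Qed.

Lemma ex_series_bounded (M : nat -> R) (B : R) :
  (forall k, 0 <= M k) -> (forall n, sum_n M n <= B) ->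
  exists m, is_series M m /\ m <= B.
Proof.
intros H0 HB; destruct (ex_finite_lim_seq_incr (sum_n M) B) as [m Hm]; auto.
- intros k; rewrite sum_Sn; change (sum_n M k <= sum_n M k + M (S k)).
  specialize (H0 (S k)); lra.
- exists m; split; [exact Hm |].
  apply (is_lim_seq_le (sum_n M) (fun _ => B) m B); auto.
  apply is_lim_seq_const.
Qed.

(** Dominated convergence for series (Tannery): beyond some rank everything is
    controlled by the tail of the majorant, and before it there are finitely
    many limits to wait for. *)
Lemma tannery (x : nat -> nat -> C) (y s : nat -> C) (l : C) (M : nat -> R) (m : R) :
  is_series M m -> (forall n k, Cmod (x n k) <= M n) ->
  (forall n eps, 0 < eps ->
     exists K, forall k, (K <= k)%nat -> Cmod (x n k - y n) < eps) ->
  (forall k, is_Cseries (fun n => x n k) (s k)) -> is_Cseries y l ->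
  forall eps, 0 < eps ->
    exists K, forall k, (K <= k)%nat -> Cmod (s k - l) < eps.
Proof.
intros HM Hx Hlim Hs Hl eps He.
assert (Hy : forall n, Cmod (y n) <= M n).
{ intros n; apply Rle_plus_epsilon; intros d Hd.
  destruct (Hlim n d Hd) as [K HK]; specialize (HK K ltac:(lia)).
  replace (y n) with (- (x n K - y n) + x n K)%C by ring.
  eapply Rle_trans; [apply Cmod_triangle |]; rewrite Cmod_opp.
  specialize (Hx n K); lra. }
assert (Hfin : forall N d, 0 < d -> exists K, forall k, (K <= k)%nat ->
          Cmod (Csum (fun n => x n k) N - Csum y N) < d).
{ induction N as [| N IH]; intros d Hd.
  - destruct (Hlim 0%nat d Hd) as [K HK]; exists K; intros k Hk.
    rewrite !sum_O; auto.
  - destruct (IH (d / 2)) as [K1 H1]; [lra |].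
    destruct (Hlim (S N) (d / 2)) as [K2 H2]; [lra |].
    exists (max K1 K2); intros k Hk; rewrite !sum_Sn.
    specialize (H1 k ltac:(lia)); specialize (H2 k ltac:(lia)).
    change (Cmod ((Csum (fun n => x n k) N + x (S N) k) - (Csum y N + y (S N))) < d).
    replace ((Csum (fun n => x n k) N + x (S N) k) - (Csum y N + y (S N)))%C
      with ((Csum (fun n => x n k) N - Csum y N) + (x (S N) k - y (S N)))%C by ring.
    eapply Rle_lt_trans; [apply Cmod_triangle |]; lra. }
assert (HN : exists N, m - sum_n M N < eps / 4).
{ assert (HM' : is_lim_seq (sum_n M) m) by exact HM.
  apply is_lim_seq_spec in HM'.
  destruct (HM' (mkposreal (eps / 4) ltac:(lra))) as [N HN]; exists N.
  specialize (HN N ltac:(lia)); simpl in HN; apply Rabs_def2 in HN; lra. }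
destruct HN as [N HN]; destruct (Hfin N (eps / 2)) as [K HK]; [lra |].
exists K; intros k Hk; specialize (HK k Hk).
assert (H1 := Cseries_tail_le (fun n => x n k) (s k) M m N (fun n => Hx n k) HM (Hs k)).
assert (H2 := Cseries_tail_le y l M m N Hy HM Hl).
replace (s k - l)%C with ((s k - Csum (fun n => x n k) N) +
  ((Csum (fun n => x n k) N - Csum y N) + - (l - Csum y N)))%C by ring.
eapply Rle_lt_trans; [apply Cmod_triangle |].
eapply Rle_lt_trans; [apply Rplus_le_compat_l, Cmod_triangle |].
rewrite Cmod_opp; lra.
Qed.

(** Interchange of summations: the partial sums in [k] of the rows are
    dominated by [M], so they pass to the limit under the sum over [n]. *)
Lemma Cseries_switch (u : nat -> nat -> C) (row col : nat -> C) (l : C)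
    (M : nat -> R) (m : R) :
  is_series M m ->
  (forall n K, sum_n (fun k => Cmod (u n k)) K <= M n) ->
  (forall n, is_Cseries (u n) (row n)) ->
  (forall k, is_Cseries (fun n => u n k) (col k)) ->
  is_Cseries row l -> is_Cseries col l.
Proof.
intros HM Hu Hrow Hcol Hl; rewrite is_Cseries_iff.
apply (tannery (fun n K => Csum (u n) K) row (Csum col) l M m); auto.
- intros n K; eapply Rle_trans; [| apply (Hu n K)].
  apply Csum_norm_le; intros k; apply Rle_refl.
- intros n; apply is_Cseries_iff, Hrow.
- induction k as [| k IH].
  + apply is_series_ext with (fun n => u n 0%nat); [intros n; now rewrite sum_O |].
    rewrite sum_O; apply Hcol.
  + apply is_series_ext with (fun n => plus (Csum (u n) k) (u n (S k)));
      [intros n; now rewrite sum_Sn |].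
    rewrite sum_Sn; now apply is_series_plus.
Qed.

(** * The complex exponential *)

Local Notation is_Cderive := (is_derive (K := R_AbsRing) (V := C_R_NormedModule)).
Local Notation Ccontinuous := (continuous (U := C_R_NormedModule)).

Lemma is_Cderive_pair (u v : R -> R) (x a b : R) :
  is_derive u x a -> is_derive v x b ->
  is_Cderive (fun t => (u t, v t)) x (a, b).
Proof.
intros Hu Hv.
apply (is_derive_scal_l (V := C_R_NormedModule) u x a (1, 0)) in Hu.
apply (is_derive_scal_l (V := C_R_NormedModule) v x b (0, 1)) in Hv.
assert (H := is_derive_plus _ _ _ _ _ Hu Hv).
replace (a, b) with
  (plus (scal a ((1, 0) : C_R_NormedModule)) (scal b ((0, 1) : C_R_NormedModule))).
- eapply is_derive_ext; [| exact H]; intros t; simpl.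
  apply injective_projections; compute; ring.
- apply injective_projections; compute; ring.
Qed.

Lemma Ccontinuous_iff (f : R -> C) (x : R) :
  Ccontinuous f x <->
  continuous (fun t => Re (f t)) x /\ continuous (fun t => Im (f t)) x.
Proof.
split.
- intros H; split; (eapply filterlim_comp; [exact H |]); destruct (f x) as [a b].
  + apply (continuous_fst (U := R_UniformSpace) (V := R_UniformSpace)).
  + apply (continuous_snd (U := R_UniformSpace) (V := R_UniformSpace)).
- intros [H1 H2] P [eps HP].
  specialize (H1 _ (locally_ball (Re (f x)) eps)).
  specialize (H2 _ (locally_ball (Im (f x)) eps)).
  unfold filtermap in *.
  generalize (filter_and _ _ H1 H2); apply filter_imp.
  intros t [Ht1 Ht2]; apply HP; split; [exact Ht1 | exact Ht2].
Qed.

Lemma Ccontinuous_mult (f g : R -> C) (x : R) :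
  Ccontinuous f x -> Ccontinuous g x -> Ccontinuous (fun t => f t * g t)%C x.
Proof.
rewrite !Ccontinuous_iff; intros [F1 F2] [G1 G2]; split.
- apply (continuous_minus (V := R_NormedModule)
    (fun t => Re (f t) * Re (g t)) (fun t => Im (f t) * Im (g t)));
    now apply (continuous_mult (K := R_AbsRing)).
- apply (continuous_plus (V := R_NormedModule)
    (fun t => Re (f t) * Im (g t)) (fun t => Im (f t) * Re (g t)));
    now apply (continuous_mult (K := R_AbsRing)).
Qed.

(** The mean value inequality, with a majorant of the derivative given by its
    antiderivative. *)
Lemma Cderive_bound (F f : R -> C) (G g : R -> R) (a b : R) :
  a <= b ->
  (forall x, a <= x <= b -> is_Cderive F x (f x)) ->
  (forall x, a <= x <= b -> Ccontinuous f x) ->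
  (forall x, a <= x <= b -> is_derive G x (g x)) ->
  (forall x, a <= x <= b -> continuous g x) ->
  (forall x, a <= x <= b -> Cmod (f x) <= g x) ->
  Cmod (F b - F a) <= G b - G a.
Proof.
intros Hab HF Hf HG Hg Hfg.
assert (H1 := is_RInt_derive (V := C_R_CompleteNormedModule) F f a b).
assert (H2 := is_RInt_derive G g a b).
rewrite Rmin_left, Rmax_right in H1, H2 by lra.
rewrite Cmod_norm.
refine (norm_RInt_le (V := C_R_NormedModule) f g a b _ _ Hab _ (H1 HF Hf) (H2 HG Hg)).
intros x Hx; rewrite <- Cmod_norm; now apply Hfg.
Qed.

Definition cexp (z : C) : C := (exp (Re z) * cos (Im z), exp (Re z) * sin (Im z)).

Lemma cexp_add (z w : C) : cexp (z + w) = (cexp z * cexp w)%C.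
Proof.
destruct z as [a b], w as [c d]; unfold cexp; simpl.
rewrite exp_plus, cos_plus, sin_plus.
apply injective_projections; simpl; ring.
Qed.

Lemma cexp_0 : cexp 0 = 1.
Proof.
unfold cexp; simpl; rewrite exp_0, cos_0, sin_0.
apply injective_projections; simpl; ring.
Qed.

Lemma Cmod_cexp (z : C) : Cmod (cexp z) = exp (Re z).
Proof.
unfold Cmod, cexp; simpl.
replace (_ + _) with (Rsqr (exp (Re z))).
- apply sqrt_Rsqr, Rlt_le, exp_pos.
- assert (H := sin2_cos2 (Im z)); unfold Rsqr in *.
  transitivity (exp (Re z) * exp (Re z) *
    (sin (Im z) * sin (Im z) + cos (Im z) * cos (Im z))); [rewrite H |]; ring.
Qed.

Lemma cexp_RtoC (x : R) : cexp (RtoC x) = RtoC (exp x).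
Proof.
unfold cexp; simpl; rewrite cos_0, sin_0.
apply injective_projections; simpl; ring.
Qed.

Lemma is_Cderive_cexp (z : C) (t : R) :
  is_Cderive (fun t => cexp (t * z)) t (z * cexp (t * z))%C.
Proof.
destruct z as [a b].
assert (E : forall t : R, cexp (t * (a, b)) =
  (exp (t * a) * cos (t * b), exp (t * a) * sin (t * b))).
{ intros s; unfold cexp; simpl.
  now replace (s * a - 0 * b) with (s * a) by ring;
    replace (s * b + 0 * a) with (s * b) by ring. }
rewrite E.
apply (is_derive_ext (V := C_R_NormedModule)
  (fun t => (exp (t * a) * cos (t * b), exp (t * a) * sin (t * b))));
  [intros s; symmetry; apply E |].
replace (Cmult _ _) with
 (exp (t * a) * (a * cos (t * b) - b * sin (t * b)),
  exp (t * a) * (a * sin (t * b) + b * cos (t * b)))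
 by (apply injective_projections; simpl; ring).
apply is_Cderive_pair; auto_derive; auto; ring.
Qed.

Lemma Ccontinuous_derive (F : R -> C) (t : R) (l : C) :
  is_Cderive F t l -> Ccontinuous F t.
Proof.
intros H; apply (ex_derive_continuous (K := R_AbsRing) (V := C_R_NormedModule)).
now exists l.
Qed.

(** Sums over [k < n]: the derivative in [t] of each is [z] times the previous
    one. *)
Fixpoint exp_partial (z : C) (n : nat) (t : R) : C :=
  match n with
  | O => 0
  | S n => exp_partial z n t + RtoC (t ^ n / INR (fact n)) * z ^ n
  end%C.

Lemma is_Cderive_exp_partial (z : C) (n : nat) (t : R) :
  is_Cderive (exp_partial z (S n)) t (z * exp_partial z n t)%C.
Proof.
assert (Hm : forall k, is_Cderive
  (fun t => RtoC (t ^ k / INR (fact k)) * z ^ k)%C t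
  (RtoC (INR k * t ^ pred k / INR (fact k)) * z ^ k)%C).
{ intros k; destruct (z ^ k)%C as [a b].
  replace (Cmult _ _) with (INR k * t ^ pred k / INR (fact k) * a,
     INR k * t ^ pred k / INR (fact k) * b)
    by (apply injective_projections; simpl; ring).
  apply (is_derive_ext (V := C_R_NormedModule)
    (fun t => (t ^ k / INR (fact k) * a, t ^ k / INR (fact k) * b))).
  - intros s; apply injective_projections; simpl; ring.
  - assert (Hk := INR_fact_neq_0 k).
    apply is_Cderive_pair; auto_derive; auto; field; auto. }
induction n as [| n IH].
- assert (H := Hm 0%nat).
  replace (z * exp_partial z 0 t)%C with (RtoC (INR 0 * t ^ pred 0 / INR (fact 0)) * z ^ 0)%C
    by (apply injective_projections; simpl; field).
  eapply is_derive_ext; [| exact H]; intros s; simpl.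
  apply injective_projections; simpl; ring.
- replace (z * exp_partial z (S n) t)%C with
    (plus (z * exp_partial z n t
     : C_R_NormedModule) (RtoC (INR (S n) * t ^ n / INR (fact (S n))) * z ^ (S n)))%C.
  + exact (is_derive_plus (V := C_R_NormedModule) _ _ t _ _ IH (Hm (S n))).
  + change (z * exp_partial z n t + RtoC (INR (S n) * t ^ n / INR (fact (S n))) * z ^ (S n)
      = z * exp_partial z (S n) t)%C.
    replace (INR (S n) * t ^ n / INR (fact (S n))) with (t ^ n / INR (fact n)).
    * simpl; ring.
    * rewrite fact_simpl, mult_INR; field; split; [apply INR_fact_neq_0 | now apply not_0_INR].
Qed.

(** Taylor's remainder: it vanishes at [0] and its derivative is [z] times the
    previous remainder, so the bound integrates up. *)
Lemma cexp_taylor (z : C) (n : nat) (t : R) : 0 <= t <= 1 ->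
  Cmod (cexp (t * z) - exp_partial z n t) <=
  exp (Cmod z) * ((Cmod z * t) ^ n / INR (fact n)).
Proof.
revert t; induction n as [| n IH]; intros t Ht.
- simpl exp_partial; replace (cexp (t * z) - 0)%C with (cexp (t * z)) by ring.
  rewrite Cmod_cexp; simpl; unfold Rdiv; rewrite Rinv_1, !Rmult_1_r.
  assert (Hz := re_le_Cmod z); apply Rabs_le_between in Hz.
  destruct (Rle_lt_or_eq_dec (t * fst z - 0 * snd z) (Cmod z)) as [H | H].
  + change (fst z) with (Re z); nra.
  + now apply Rlt_le, exp_increasing.
  + rewrite H; lra.
- set (E := fun k t => (cexp (RtoC t * z) - exp_partial z k t)%C) in *.
  assert (HD : forall x, is_Cderive (E (S n)) x (z * E n x)%C).
  { intros x; replace (z * E n x)%C with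
      (minus (z * cexp (x * z) : C_R_NormedModule)%C (z * exp_partial z n x)%C).
    - apply (is_derive_minus (V := C_R_NormedModule)).
      apply is_Cderive_cexp. apply is_Cderive_exp_partial.
    - change (z * cexp (x * z) - z * exp_partial z n x = z * E n x)%C.
      unfold E; ring. }
  assert (E0 : E (S n) 0 = 0).
  { unfold E; replace (RtoC 0 * z)%C with (RtoC 0) by ring; rewrite cexp_0.
    clear; induction n as [| n IH].
    - apply injective_projections; simpl; field.
    - change (exp_partial z (S (S n)) 0) with
        (exp_partial z (S n) 0 + RtoC (0 ^ S n / INR (fact (S n))) * z ^ S n)%C.
      rewrite pow_i by lia; unfold Rdiv; rewrite Rmult_0_l.
      transitivity (1 - exp_partial z (S n) 0)%C; [ring | exact IH]. }
  replace (cexp (t * z) - exp_partial z (S n) t)%C with (E (S n) t - E (S n) 0)%C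
    by (rewrite E0; unfold E; ring).
  pose (G := fun t => exp (Cmod z) * ((Cmod z * t) ^ S n / INR (fact (S n)))).
  replace (exp (Cmod z) * _) with (G t - G 0).
  2: { unfold G; rewrite Rmult_0_r, pow_i by lia; unfold Rdiv; ring. }
  pose (g := fun t => Cmod z * (exp (Cmod z) * ((Cmod z * t) ^ n / INR (fact n)))).
  apply (Cderive_bound _ (fun x => z * E n x)%C _ g); try lra.
  + intros x _; apply HD.
  + intros x _; apply Ccontinuous_mult; [apply continuous_const |].
    apply (continuous_minus (V := C_R_NormedModule)).
    * exact (Ccontinuous_derive _ _ _ (is_Cderive_cexp z x)).
    * destruct n as [| n]; [apply continuous_const |].
      exact (Ccontinuous_derive _ _ _ (is_Cderive_exp_partial z n x)).
  + intros x _; unfold G, g.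
    assert (Hn : INR (S n) <> 0) by now apply not_0_INR.
    assert (Hk := INR_fact_neq_0 n).
    replace (INR (fact (S n))) with (INR (S n) * INR (fact n))
      by now rewrite fact_simpl, mult_INR.
    auto_derive; auto.
    change (match n with O => 1 | S _ => INR n + 1 end) with (INR (S n)).
    simpl pred; field; auto.
  + intros x _; apply (ex_derive_continuous (K := R_AbsRing) (V := R_NormedModule)).
    unfold g; auto_derive; auto.
  + intros x Hx; rewrite Cmod_mult; unfold g.
    apply Rmult_le_compat_l; [apply Cmod_ge_0 | apply IH; lra].
Qed.

Lemma is_series_exp (x : R) : is_series (fun n => / INR (fact n) * x ^ n) (exp x).
Proof. apply is_pseries_R, is_exp_Reals. Qed.

Lemma cexp_series (z : C) :
  is_Cseries (fun n => RtoC (/ INR (fact n)) * z ^ n)%C (cexp z).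
Proof.
apply is_Cseries_iff; intros eps He.
assert (Hsum : forall n, Csum (fun n => RtoC (/ INR (fact n)) * z ^ n)%C n =
                         exp_partial z (S n) 1).
{ assert (Hp : forall n, exp_partial z (S n) 1 =
     (exp_partial z n 1 + RtoC (/ INR (fact n)) * z ^ n)%C).
  { intros n; simpl exp_partial; now rewrite pow1; unfold Rdiv; rewrite Rmult_1_l. }
  induction n as [| n IH]; rewrite Hp.
  - rewrite sum_O; symmetry; apply Cplus_0_l.
  - rewrite sum_Sn, IH; reflexivity. }
assert (Hlim : is_lim_seq (fun n => / INR (fact n) * Cmod z ^ n) 0).
{ apply ex_series_lim_0; exists (exp (Cmod z)); apply is_series_exp. }
apply is_lim_seq_spec in Hlim.
assert (Hd : 0 < eps / exp (Cmod z)) by (apply Rdiv_lt_0_compat; [lra | apply exp_pos]).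
destruct (Hlim (mkposreal _ Hd)) as [N HN]; exists N; intros n Hn.
specialize (HN (S n) ltac:(lia)); simpl pos in HN; apply Rabs_def2 in HN as [HN _].
rewrite Hsum, Cmod_minus_sym.
assert (H := cexp_taylor z (S n) 1 ltac:(lra)).
rewrite Cmult_1_l, Rmult_1_r in H.
eapply Rle_lt_trans; [exact H |].
apply Rmult_lt_compat_l with (r := exp (Cmod z)) in HN; [| apply exp_pos].
replace eps with (exp (Cmod z) * (eps / exp (Cmod z)))
  by (field; apply Rgt_not_eq, exp_pos).
eapply Rle_lt_trans; [| exact HN]; apply Req_le; unfold Rdiv; ring.
Qed.

(** * Absolutely convergent power series *)

(** [f] is the sum, on the closed disc of radius [r], of a power series with
    [sum |c_k| r^k <= M].  Such functions form a Banach algebra, in which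
    analyticity of a compound expression comes with a bound that makes infinite
    sums of such expressions analytic again, without Cauchy's formula. *)
Definition power_sum (r M : R) (f : C -> C) : Prop :=
  exists c : nat -> C,
    (forall n, sum_n (fun k => Cmod (c k) * r ^ k) n <= M) /\
    (forall z, Cmod z <= r -> is_Cseries (fun k => c k * z ^ k)%C (f z)).

Lemma power_sum_term (r M : R) (c : nat -> C) (k : nat) : 0 <= r ->
  (forall n, sum_n (fun k => Cmod (c k) * r ^ k) n <= M) -> Cmod (c k) * r ^ k <= M.
Proof.
intros Hr H; eapply Rle_trans; [| apply (H k)].
assert (Hp : forall j, 0 <= Cmod (c j) * r ^ j).
{ intros j; apply Rmult_le_pos; [apply Cmod_ge_0 | now apply pow_le]. }
assert (Hs : forall j, 0 <= sum_n (fun k => Cmod (c k) * r ^ k) j).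
{ induction j as [| j IH]; rewrite ?sum_O, ?sum_Sn; [apply Hp |].
  now apply Rplus_le_le_0_compat. }
destruct k as [| k]; rewrite ?sum_O, ?sum_Sn; [apply Rle_refl |].
change (Cmod (c (S k)) * r ^ S k <= sum_n (fun k => Cmod (c k) * r ^ k) k +
  Cmod (c (S k)) * r ^ S k).
specialize (Hs k); lra.
Qed.

Lemma power_sum_pow_le (r : R) (c z : C) (k : nat) :
  Cmod z <= r -> Cmod (c * z ^ k) <= Cmod c * r ^ k.
Proof.
intros Hz; rewrite Cmod_mult, Cmod_pow.
apply Rmult_le_compat_l; [apply Cmod_ge_0 |].
apply pow_incr; split; [apply Cmod_ge_0 | exact Hz].
Qed.

Lemma power_sum_bound (r M : R) (f : C -> C) (z : C) :
  power_sum r M f -> Cmod z <= r -> Cmod (f z) <= M.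
Proof.
intros [c [Hc Hf]] Hz.
assert (Hr : 0 <= r) by (eapply Rle_trans; [apply Cmod_ge_0 | exact Hz]).
destruct (ex_series_bounded (fun k => Cmod (c k) * r ^ k) M) as [m [Hm Hle]]; auto.
{ intros k; apply Rmult_le_pos; [apply Cmod_ge_0 | now apply pow_le]. }
apply Rle_trans with m; [| exact Hle].
apply (Cseries_norm_le _ _ (fun k => Cmod (c k) * r ^ k) m) with (3 := Hf z Hz); auto.
intros k; now apply power_sum_pow_le.
Qed.

Lemma power_sum_ext (r M : R) (f g : C -> C) :
  (forall z, Cmod z <= r -> f z = g z) -> power_sum r M f -> power_sum r M g.
Proof.
intros H [c [Hc Hf]]; exists c; split; auto.
intros z Hz; rewrite <- (H z Hz); auto.
Qed.

Lemma power_sum_le (r M M' : R) (f : C -> C) :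
  M <= M' -> power_sum r M f -> power_sum r M' f.
Proof.
intros H [c [Hc Hf]]; exists c; split; auto.
intros n; eapply Rle_trans; eauto.
Qed.

Lemma power_sum_scal (r M : R) (a : C) (f : C -> C) :
  power_sum r M f -> power_sum r (Cmod a * M) (fun z => a * f z)%C.
Proof.
intros [c [Hc Hf]]; exists (fun k => a * c k)%C; split.
- intros n; rewrite (sum_n_ext _ (fun k => scal (Cmod a) (Cmod (c k) * r ^ k))).
  + rewrite sum_n_scal_l.
    apply Rmult_le_compat_l; [apply Cmod_ge_0 | apply Hc].
  + intros k; rewrite Cmod_mult, Rmult_assoc; reflexivity.
- intros z Hz; apply is_series_ext with (fun k => scal a (c k * z ^ k)%C).
  + intros k; apply Cmult_assoc.
  + apply (is_series_scal (K := C_AbsRing) (V := C_NormedModule)); auto.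
Qed.

Lemma power_sum_plus (r M N : R) (f g : C -> C) :
  power_sum r M f -> power_sum r N g -> 0 <= r ->
  power_sum r (M + N) (fun z => f z + g z)%C.
Proof.
intros [c [Hc Hf]] [d [Hd Hg]] Hr; exists (fun k => c k + d k)%C; split.
- intros n; eapply Rle_trans; [| apply (Rplus_le_compat _ _ _ _ (Hc n) (Hd n))].
  rewrite <- (sum_n_plus (G := R_AbelianMonoid)
    (fun k => Cmod (c k) * r ^ k) (fun k => Cmod (d k) * r ^ k)).
  apply sum_n_mono; intros k; change (@plus R_AbelianMonoid) with Rplus.
  rewrite <- Rmult_plus_distr_r; apply Rmult_le_compat_r; [now apply pow_le |].
  apply Cmod_triangle.
- intros z Hz; apply is_series_ext with (fun k => plus (c k * z ^ k)%C (d k * z ^ k)%C).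
  + intros k; change (c k * z ^ k + d k * z ^ k = (c k + d k) * z ^ k)%C; ring.
  + apply (is_series_plus (K := C_AbsRing) (V := C_NormedModule)
      (fun k => c k * z ^ k)%C (fun k => d k * z ^ k)%C (f z) (g z)); auto.
Qed.

Lemma power_sum_shift (r M : R) (f : C -> C) : 0 <= r ->
  power_sum r M f -> power_sum r (r * M) (fun z => z * f z)%C.
Proof.
intros Hr [c [Hc Hf]].
exists (fun k => match k with O => RtoC 0 | S k => c k end); split.
- assert (HM : 0 <= M).
  { eapply Rle_trans; [| apply (Hc 0%nat)]; rewrite sum_O.
    apply Rmult_le_pos; [apply Cmod_ge_0 | now apply pow_le]. }
  assert (H : forall n, sum_n (fun k => Cmod match k with O => RtoC 0 | S k => c k end * r ^ k)
     (S n) = r * sum_n (fun k => Cmod (c k) * r ^ k) n).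
  { induction n as [| n IH].
    - rewrite sum_Sn, !sum_O, Cmod_0; unfold plus; simpl; ring.
    - rewrite sum_Sn, IH, (sum_Sn _ n); unfold plus; simpl; ring. }
  intros [| n].
  + rewrite sum_O, Cmod_0, Rmult_0_l; now apply Rmult_le_pos.
  + rewrite H; now apply Rmult_le_compat_l.
- intros z Hz.
  apply (is_series_decr_1 (K := C_AbsRing) (V := C_NormedModule)).
  replace (plus (z * f z : C_NormedModule)%C _) with (scal z (f z : C_NormedModule)).
  + apply is_series_ext with (fun k => scal z (c k * z ^ k)%C).
    * intros k; change (z * (c k * z ^ k) = c k * (z * z ^ k))%C; ring.
    * apply (is_series_scal (K := C_AbsRing) (V := C_NormedModule)); auto.
  + change (z * f z = z * f z + - (0 * z ^ 0))%C; ring.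
Qed.

Lemma power_sum_monomial (r M : R) (n : nat) (f : C -> C) : 0 <= r ->
  power_sum r M f -> power_sum r (r ^ n * M) (fun z => z ^ n * f z)%C.
Proof.
intros Hr Hf; induction n as [| n IH].
- simpl; rewrite Rmult_1_l; eapply power_sum_ext; [| exact Hf].
  intros z _; simpl; ring.
- apply (power_sum_shift r _ _ Hr) in IH; simpl.
  rewrite <- Rmult_assoc in IH; eapply power_sum_ext; [| exact IH].
  intros z _; simpl; ring.
Qed.

(** Completeness of the algebra: the coefficients are summed termwise. *)
Lemma power_sum_series (r m : R) (M : nat -> R) (f : nat -> C -> C) (F : C -> C) :
  0 < r -> is_series M m -> (forall n, power_sum r (M n) (f n)) ->
  (forall z, Cmod z <= r -> is_Cseries (fun n => f n z) (F z)) ->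
  power_sum r m F.
Proof.
intros Hr HM Hf HF.
destruct (functional_choice _ Hf) as [c Hc].
assert (Hterm : forall n k, Cmod (c n k) <= / r ^ k * M n).
{ intros n k; assert (H := power_sum_term r (M n) (c n) k (Rlt_le _ _ Hr) (proj1 (Hc n))).
  assert (Hk := pow_lt r k Hr).
  apply Rmult_le_reg_l with (r ^ k); [exact Hk |].
  rewrite <- Rmult_assoc, Rinv_r by lra; lra. }
assert (HC : forall k, exists s, is_Cseries (fun n => c n k) s).
{ intros k; apply ex_Cseries_le with (fun n => / r ^ k * M n); [intros n; apply Hterm |].
  exists (/ r ^ k * m); now apply (is_series_scal (K := R_AbsRing) (V := R_NormedModule)). }
destruct (functional_choice _ HC) as [d Hd]; exists d.
assert (Hpos : forall n k, 0 <= Cmod (c n k) * r ^ k).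
{ intros n k; apply Rmult_le_pos; [apply Cmod_ge_0 | apply Rlt_le, pow_lt, Hr]. }
split.
- intros K.
  assert (Habs : forall k, ex_series (fun n => Cmod (c n k))).
  { intros k; apply (ex_series_le (V := R_CompleteNormedModule) _ (fun n => / r ^ k * M n)).
    - intros n; unfold norm; simpl; unfold abs; simpl.
      rewrite Rabs_pos_eq by apply Cmod_ge_0; apply Hterm.
    - exists (/ r ^ k * m); now apply (is_series_scal (K := R_AbsRing) (V := R_NormedModule)). }
  set (A := fun k => Series (fun n => Cmod (c n k))).
  assert (HA : forall k, Cmod (d k) <= A k).
  { intros k; apply (Cseries_norm_le (fun n => c n k) _ (fun n => Cmod (c n k))); auto.
    - intros n; apply Rle_refl.
    - now apply Series_correct. }
  apply Rle_trans with (sum_n (fun k => A k * r ^ k) K).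
  { apply sum_n_mono; intros k; apply Rmult_le_compat_r; auto.
    apply Rlt_le, pow_lt, Hr. }
  assert (HS : is_series (fun n => sum_n (fun k => Cmod (c n k) * r ^ k) K)
                         (sum_n (fun k => A k * r ^ k) K)).
  { assert (H1 : forall k, is_series (fun n => Cmod (c n k) * r ^ k) (A k * r ^ k)).
    { intros k; apply is_series_scal_r; now apply Series_correct. }
    induction K as [| K IH].
    - apply is_series_ext with (fun n => Cmod (c n 0%nat) * r ^ 0);
        [intros n; now rewrite sum_O |].
      rewrite sum_O; apply H1.
    - apply is_series_ext with (fun n =>
        plus (sum_n (fun k => Cmod (c n k) * r ^ k) K) (Cmod (c n (S K)) * r ^ S K));
        [intros n; now rewrite sum_Sn |].
      rewrite sum_Sn; now apply (is_series_plus (K := R_AbsRing) (V := R_NormedModule)). }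
  rewrite <- (is_series_unique _ _ HS), <- (is_series_unique _ _ HM).
  apply Series_le; [| now exists m].
  intros n; split; [| apply (proj1 (Hc n))].
  clear -Hpos; induction K as [| K IH]; rewrite ?sum_O, ?sum_Sn; auto.
  now apply Rplus_le_le_0_compat.
- intros z Hz.
  apply (Cseries_switch (fun n k => c n k * z ^ k)%C (fun n => f n z) _ _ M m HM).
  + intros n K; eapply Rle_trans; [| apply (proj1 (Hc n) K)].
    apply sum_n_mono; intros k; now apply power_sum_pow_le.
  + intros n; now apply (proj2 (Hc n)).
  + intros k; apply is_series_ext with (fun n => scal (z ^ k : C_AbsRing)%C (c n k : C_NormedModule)).
    * intros n; apply Cmult_comm.
    * rewrite Cmult_comm.
      now apply (is_series_scal (K := C_AbsRing) (V := C_NormedModule) (z ^ k)%C).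
  + now apply HF.
Qed.

(** Multiply the second factor by each monomial of the first, and sum. *)
Lemma power_sum_mult (r M N : R) (f g : C -> C) : 0 < r ->
  power_sum r M f -> power_sum r N g ->
  power_sum r (M * N) (fun z => f z * g z)%C.
Proof.
intros Hr [c [Hc Hf]] Hg.
assert (HN : 0 <= N).
{ eapply Rle_trans; [apply Cmod_ge_0 |].
  apply (power_sum_bound r N g 0 Hg); rewrite Cmod_0; lra. }
destruct (ex_series_bounded (fun k => Cmod (c k) * r ^ k) M) as [m [Hm Hle]]; auto.
{ intros k; apply Rmult_le_pos; [apply Cmod_ge_0 | apply Rlt_le, pow_lt, Hr]. }
apply power_sum_le with (m * N); [now apply Rmult_le_compat_r |].
apply (power_sum_series r (m * N) (fun k => Cmod (c k) * r ^ k * N)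
  (fun k z => c k * (z ^ k * g z))%C); auto.
- now apply is_series_scal_r.
- intros k; rewrite Rmult_assoc; apply power_sum_scal, power_sum_monomial; auto; lra.
- intros z Hz; apply is_series_ext with (fun k => scal (g z : C_AbsRing) (c k * z ^ k)%C).
  + intros k; change (g z * (c k * z ^ k) = c k * (z ^ k * g z))%C; ring.
  + rewrite Cmult_comm.
    apply (is_series_scal (K := C_AbsRing) (V := C_NormedModule)); auto.
Qed.

Lemma power_sum_const (r : R) (a : C) : 0 <= r -> power_sum r (Cmod a) (fun _ => a).
Proof.
intros Hr; exists (fun k => match k with O => a | S _ => RtoC 0 end); split.
- intros n; apply Req_le; induction n as [| n IH]; rewrite ?sum_O, ?sum_Sn.
  + simpl; ring.
  + rewrite IH, Cmod_0, Rmult_0_l; apply Rplus_0_r.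
- intros z _; apply is_Cseries_iff; intros eps He; exists 0%nat; intros n _.
  replace (Csum _ n) with a.
  + replace (a - a)%C with (RtoC 0) by ring; rewrite Cmod_0; lra.
  + induction n as [| n IH]; rewrite ?sum_O, ?sum_Sn; [simpl; ring | rewrite <- IH].
    change (a = a + 0 * z ^ S n)%C; ring.
Qed.

Lemma power_sum_pow (r M : R) (f : C -> C) (n : nat) : 0 < r ->
  power_sum r M f -> power_sum r (M ^ n) (fun z => f z ^ n)%C.
Proof.
intros Hr Hf; induction n as [| n IH]; simpl.
- apply power_sum_le with (Cmod 1); [rewrite Cmod_1; lra |].
  apply power_sum_const; lra.
- now apply power_sum_mult.
Qed.

Lemma power_sum_affine (r : R) (a b : C) : 0 < r ->
  power_sum r (Cmod a + Cmod b * r) (fun z => a + b * z)%C.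
Proof.
intros Hr; apply power_sum_plus; try lra.
- apply power_sum_const; lra.
- apply power_sum_scal.
  apply (power_sum_ext r r (fun z => z * 1)%C); [intros; ring |].
  replace r with (r * Cmod 1) at 2 by (rewrite Cmod_1; ring).
  apply (power_sum_shift r (Cmod 1) (fun _ => RtoC 1)); [lra |].
  apply power_sum_const; lra.
Qed.

Lemma power_sum_cexp (r M : R) (f : C -> C) : 0 < r ->
  power_sum r M f -> power_sum r (exp M) (fun z => cexp (f z)).
Proof.
intros Hr Hf.
apply (power_sum_series r _ (fun n => / INR (fact n) * M ^ n)
  (fun n z => RtoC (/ INR (fact n)) * f z ^ n)%C); auto.
- apply is_series_exp.
- intros n.
  assert (H : 0 < / INR (fact n)) by apply Rinv_0_lt_compat, INR_fact_lt_0.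
  rewrite <- (Rabs_pos_eq (/ INR (fact n))) at 1 by lra.
  rewrite <- Cmod_R; now apply power_sum_scal, power_sum_pow.
- intros z _; apply cexp_series.
Qed.

(** The remainder is [f^2 sum_j f^j / (j+2)!]. *)
Lemma power_sum_cexp_remainder (r M : R) (f : C -> C) : 0 < r ->
  power_sum r M f ->
  power_sum r (M ^ 2 * exp M) (fun z => cexp (f z) - 1 - f z)%C.
Proof.
intros Hr Hf.
assert (HM : 0 <= M).
{ eapply Rle_trans; [apply Cmod_ge_0 |].
  apply (power_sum_bound r M f 0 Hf); rewrite Cmod_0; lra. }
apply (power_sum_series r _ (fun n => M ^ 2 * (/ INR (fact n) * M ^ n))
  (fun n z => RtoC (/ INR (fact (2 + n))) * f z ^ (2 + n))%C); auto.
- apply (is_series_scal (K := R_AbsRing) (V := R_NormedModule)), is_series_exp.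
- intros n.
  assert (H0 : 0 < INR (fact n)) by apply INR_fact_lt_0.
  assert (H1 : 0 < INR (fact (2 + n))) by apply INR_fact_lt_0.
  apply power_sum_le with (Rabs (/ INR (fact (2 + n))) * M ^ (2 + n)).
  + rewrite Rabs_pos_eq by (apply Rlt_le, Rinv_0_lt_compat, H1).
    rewrite pow_add.
    replace (M ^ 2 * (/ INR (fact n) * M ^ n)) with (/ INR (fact n) * (M ^ 2 * M ^ n)) by ring.
    apply Rmult_le_compat_r; [apply Rmult_le_pos; now apply pow_le |].
    apply Rinv_le_contravar; [exact H0 |].
    apply le_INR, fact_le; lia.
  + rewrite <- Cmod_R; now apply power_sum_scal, power_sum_pow.
- intros z _.
  apply (is_series_incr_n (K := C_AbsRing) (V := C_NormedModule)
    (fun n => RtoC (/ INR (fact n)) * f z ^ n)%C 2); [lia |].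
  replace (plus (cexp (f z) - 1 - f z : C_NormedModule)%C _) with (cexp (f z));
    [apply cexp_series |].
  simpl pred; rewrite sum_Sn, sum_O.
  change (cexp (f z) = cexp (f z) - 1 - f z + (RtoC (/ 1) * 1 + RtoC (/ 1) * (f z * 1)))%C.
  rewrite Rinv_1; ring.
Qed.

Lemma Cgeom (z : C) : Cmod z < 1 -> is_Cseries (fun n => z ^ n)%C (/ (1 - z))%C.
Proof.
intros Hz.
assert (Hne : (1 - z <> 0)%C).
{ intros E; replace z with (RtoC 1) in Hz; [rewrite Cmod_1 in Hz; lra |].
  replace z with (1 - (1 - z))%C by ring; rewrite E; ring. }
assert (Hd : 0 < Cmod (1 - z)) by now apply Cmod_gt_0.
assert (Hs : forall n, Csum (fun n => z ^ n)%C n = ((1 - z ^ S n) / (1 - z))%C).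
{ induction n as [| n IH]; rewrite ?sum_O, ?sum_Sn.
  - simpl; field; exact Hne.
  - rewrite IH; change ((1 - z ^ S n) / (1 - z) + z ^ S n = (1 - z ^ S (S n)) / (1 - z))%C.
    simpl; field; exact Hne. }
apply is_Cseries_iff; intros eps He.
assert (Hl : is_lim_seq (fun n => Cmod z ^ n) 0).
{ apply is_lim_seq_geom; rewrite Rabs_pos_eq; auto using Cmod_ge_0. }
apply is_lim_seq_spec in Hl.
assert (Hp : 0 < eps * Cmod (1 - z)) by now apply Rmult_lt_0_compat.
destruct (Hl (mkposreal _ Hp)) as [N HN]; exists N; intros n Hn.
specialize (HN (S n) ltac:(lia)); simpl pos in HN; apply Rabs_def2 in HN as [HN _].
rewrite Hs.
replace ((1 - z ^ S n) / (1 - z) - / (1 - z))%C with (- (z ^ S n / (1 - z)))%C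
  by (field; exact Hne).
rewrite Cmod_opp, Cmod_div, Cmod_pow by exact Hne.
apply Rmult_lt_reg_r with (Cmod (1 - z)); [exact Hd |].
unfold Rdiv; rewrite Rmult_assoc, Rinv_l by lra; lra.
Qed.

(** The geometric series in [- z / a]. *)
Lemma power_sum_inv_affine (r : R) (a : C) : 0 < r -> r < Cmod a ->
  power_sum r (/ (Cmod a - r)) (fun z => / (a + z))%C.
Proof.
intros Hr Ha.
assert (Hne : a <> 0) by (apply Cmod_gt_0; lra).
apply (power_sum_ext r _ (fun z => / a * / (1 - (- / a * z)))%C).
- intros z Hz.
  assert (a + z <> 0)%C.
  { intros E; replace a with (- z)%C in Ha; [rewrite Cmod_opp in Ha; lra |].
    replace z with (a + z - a)%C by ring; rewrite E; ring. }
  field; split; auto.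
- assert (Hq : Rabs (r / Cmod a) < 1).
  { rewrite Rabs_pos_eq by (apply Rlt_le, Rdiv_lt_0_compat; lra).
    apply Rlt_div_l; lra. }
  replace (/ (Cmod a - r)) with (Cmod (/ a) * / (1 - r / Cmod a))
    by (rewrite Cmod_inv by exact Hne; field; lra).
  apply power_sum_scal.
  apply (power_sum_series r _ (fun n => (r / Cmod a) ^ n) (fun n z => (- / a * z) ^ n)%C);
    auto.
  + now apply is_series_geom.
  + intros n; apply power_sum_pow; auto.
    apply (power_sum_ext r _ (fun z => 0 + (- / a) * z)%C); [intros; ring |].
    replace (r / Cmod a) with (Cmod 0 + Cmod (- / a) * r)
      by (rewrite Cmod_0, Cmod_opp, Cmod_inv by exact Hne; field; lra).
    now apply power_sum_affine.
  + intros z Hz; apply Cgeom.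
    rewrite Cmod_mult, Cmod_opp, Cmod_inv by exact Hne.
    rewrite Rabs_pos_eq in Hq by (apply Rlt_le, Rdiv_lt_0_compat; lra).
    eapply Rle_lt_trans; [| exact Hq]; unfold Rdiv; rewrite Rmult_comm.
    apply Rmult_le_compat_r; [apply Rlt_le, Rinv_0_lt_compat; lra | exact Hz].
Qed.

Lemma is_pseries_Cpow (c : nat -> C) (w l : C) :
  is_pseries (K := C_AbsRing) (V := C_NormedModule) c w l <->
  is_Cseries (fun k => c k * w ^ k)%C l.
Proof.
assert (E : forall k, (c k * w ^ k)%C =
  scal (pow_n (w : C_AbsRing) k) (c k : C_NormedModule)).
{ intros k; enough (Ek : pow_n (w : C_AbsRing) k = (w ^ k)%C)
    by (rewrite Ek; apply Cmult_comm).
  induction k as [| k IH]; simpl; [reflexivity | now rewrite IH]. }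
split; apply is_series_ext; intros k; rewrite E; reflexivity.
Qed.

Lemma power_sum_analytic (r M : R) (f : C -> C) (z0 : C) : 0 < r ->
  power_sum r M (fun w => f (z0 + w)%C) -> analytic_at f z0.
Proof.
intros Hr [c [_ Hf]]; exists c, (mkposreal r Hr); intros z Hz; simpl in Hz.
specialize (Hf (z - z0)%C (Rlt_le _ _ Hz)).
replace (z0 + (z - z0))%C with z in Hf by ring.
now apply is_pseries_Cpow.
Qed.

(** * The identity theorem *)

(** Zeros of a nonzero analytic function are isolated: if [c_k] is the first
    nonzero coefficient, [f z] is [c_k w^k] up to [O (w^(k+1))], [w = z - z0]. *)
Lemma analytic_isolated_zeros (f : C -> C) (z0 : C) :
  analytic_at f z0 ->
  (forall eps, 0 < eps -> exists z, 0 < Cmod (z - z0) < eps /\ f z = 0) ->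
  exists r, 0 < r /\ forall z, Cmod (z - z0) < r -> f z = 0.
Proof.
intros [c [r Hf]] Hz; exists r; split; [apply cond_pos |].
assert (Hf' : forall z, Cmod (z - z0) < r ->
  is_Cseries (fun k => c k * (z - z0) ^ k)%C (f z))
  by (intros z H; now apply is_pseries_Cpow, Hf).
clear Hf; set (rho := r / 2); assert (Hr := cond_pos r).
assert (Hrho : 0 < rho) by (unfold rho; lra).
assert (HB : exists B, 0 < B /\ forall k, Cmod (c k) * rho ^ k <= B).
{ assert (Hw : Cmod (z0 + RtoC rho - z0) < r).
  { replace (z0 + RtoC rho - z0)%C with (RtoC rho) by ring.
    rewrite Cmod_R, Rabs_pos_eq by lra; unfold rho; lra. }
  specialize (Hf' _ Hw).
  replace (z0 + RtoC rho - z0)%C with (RtoC rho) in Hf' by ring.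
  destruct (filterlim_bounded (V := C_NormedModule) _ (ex_intro _ _ Hf')) as [M HM].
  assert (HM' : forall n, Cmod (Csum (fun k => c k * RtoC rho ^ k)%C n) <= M) by exact HM.
  assert (HM0 : 0 <= M) by (eapply Rle_trans; [apply Cmod_ge_0 | apply (HM' 0%nat)]).
  exists (M + M + 1); split; [lra |].
  intros k; replace (Cmod (c k) * rho ^ k) with (Cmod (c k * RtoC rho ^ k)).
  2: { rewrite Cmod_mult, Cmod_pow, Cmod_R, Rabs_pos_eq by lra; reflexivity. }
  destruct k as [| k].
  - specialize (HM' 0%nat); rewrite sum_O in HM'; lra.
  - assert (H1 := HM' k); assert (H2 := HM' (S k)); rewrite sum_Sn in H2.
    set (S0 := Csum _ k) in *; set (u := (c (S k) * RtoC rho ^ S k)%C) in *.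
    change (Cmod (S0 + u) <= M) in H2.
    replace u with (S0 + u + - S0)%C by ring.
    eapply Rle_trans; [apply Cmod_triangle |]; rewrite Cmod_opp; lra. }
destruct HB as [B [HB0 HB]].
assert (Hc : forall k, c k = 0).
{ induction k as [k IH] using (well_founded_induction Wf_nat.lt_wf).
  apply Cmod_le_0; intros eps He.
  assert (Hpk : 0 < rho ^ k) by now apply pow_lt.
  assert (Hd : 0 < Rmin (rho / 2) (eps * rho ^ k * rho / (2 * B))).
  { apply Rmin_pos; [lra |]; apply Rdiv_lt_0_compat; [| lra].
    repeat apply Rmult_lt_0_compat; lra. }
  destruct (Hz _ Hd) as [z [[Hz0 Hz1] Hfz]].
  assert (H1 := Rlt_le_trans _ _ _ Hz1 (Rmin_l _ _)).
  assert (H2 := Rlt_le_trans _ _ _ Hz1 (Rmin_r _ _)).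
  assert (Hs : is_Cseries (fun k => c k * (z - z0) ^ k)%C (RtoC 0))
    by (rewrite <- Hfz; apply Hf'; unfold rho in *; lra).
  set (w := (z - z0)%C) in *; set (q := Cmod w / rho).
  assert (Hq : 0 < q <= / 2).
  { unfold q; split; [now apply Rdiv_lt_0_compat |].
    apply Rle_div_l; lra. }
  assert (Hu : forall j, Cmod (c j * w ^ j) <= B * q ^ j).
  { intros j; rewrite Cmod_mult, Cmod_pow.
    replace (Cmod w) with (rho * q) by (unfold q; field; lra).
    rewrite Rpow_mult_distr, <- Rmult_assoc.
    apply Rmult_le_compat_r; [apply pow_le; lra | apply HB]. }
  assert (Hk : forall j, Cmod (Csum (fun k => c k * w ^ k)%C (k + j) - c k * w ^ k) <=
                         2 * B * q ^ S k * (1 - (/ 2) ^ j)).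
  { induction j as [| j IHj].
    - replace (Csum _ (k + 0)) with (c k * w ^ k)%C.
      + replace (c k * w ^ k - c k * w ^ k)%C with (RtoC 0) by ring.
        rewrite Cmod_0; simpl; lra.
      + rewrite Nat.add_0_r; clear -IH.
        assert (H0 : forall n, (n < k)%nat -> Csum (fun k => c k * w ^ k)%C n = RtoC 0).
        { induction n as [| n IHn]; intros Hn; rewrite ?sum_O, ?sum_Sn, IH by lia.
          - apply Cmult_0_l.
          - rewrite IHn, Cmult_0_l by lia; apply Cplus_0_l. }
        destruct k as [| k]; rewrite ?sum_O, ?sum_Sn; [reflexivity |].
        rewrite H0 by lia; symmetry; apply Cplus_0_l.
    - rewrite Nat.add_succ_r, sum_Sn.
      set (S0 := Csum _ (k + j)) in *; specialize (Hu (S (k + j))).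
      set (u := (c (S (k + j)) * w ^ S (k + j))%C) in *.
      change (Cmod (S0 + u - c k * w ^ k) <= 2 * B * q ^ S k * (1 - (/ 2) ^ S j)).
      replace (S0 + u - c k * w ^ k)%C with ((S0 - c k * w ^ k) + u)%C by ring.
      eapply Rle_trans; [apply Cmod_triangle |].
      assert (Hj : q ^ j <= (/ 2) ^ j) by (apply pow_incr; lra).
      replace (q ^ S (k + j)) with (q ^ S k * q ^ j) in Hu
        by now rewrite <- pow_add.
      assert (Hp : 0 < B * q ^ S k) by (apply Rmult_lt_0_compat; [| apply pow_lt]; lra).
      apply Rmult_le_compat_l with (r := B * q ^ S k) in Hj; [| lra].
      simpl; simpl in *; lra. }
  assert (Hle : Cmod (c k * w ^ k) <= 2 * B * q ^ S k).
  { apply Rle_plus_epsilon; intros d Hd'.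
    rewrite is_Cseries_iff in Hs; destruct (Hs d Hd') as [N HN].
    specialize (HN (k + N)%nat ltac:(lia)); specialize (Hk N).
    set (S0 := Csum _ (k + N)) in *.
    replace (c k * w ^ k)%C with (- (S0 - c k * w ^ k) + (S0 - 0))%C by ring.
    eapply Rle_trans; [apply Cmod_triangle |]; rewrite Cmod_opp.
    assert (Hh : 0 < (/ 2) ^ N) by (apply pow_lt; lra).
    assert (Hp : 0 < B * q ^ S k) by (apply Rmult_lt_0_compat; [| apply pow_lt]; lra).
    nra. }
  rewrite Cmod_mult, Cmod_pow in Hle.
  replace (Cmod w) with (rho * q) in Hle by (unfold q; field; lra).
  rewrite Rpow_mult_distr in Hle; simpl in Hle.
  assert (Hqk : 0 < q ^ k) by (apply pow_lt; lra).
  assert (H3 : Cmod (c k) * rho ^ k <= 2 * B * q).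
  { apply Rmult_le_reg_r with (q ^ k); [exact Hqk |]; lra. }
  assert (H4 : 2 * B * q < eps * rho ^ k).
  { unfold q; apply Rmult_lt_reg_r with (rho / (2 * B)); [apply Rdiv_lt_0_compat; lra |].
    replace (2 * B * (Cmod w / rho) * (rho / (2 * B))) with (Cmod w) by (field; lra).
    replace (eps * rho ^ k * (rho / (2 * B))) with (eps * rho ^ k * rho / (2 * B))
      by (field; lra); exact H2. }
  apply Rmult_le_reg_r with (rho ^ k); lra. }
intros z H; apply (is_Cseries_inj (fun k => c k * (z - z0) ^ k)%C); [now apply Hf' |].
apply is_Cseries_iff; intros eps He; exists 0%nat; intros n _.
replace (Csum _ n) with (RtoC 0).
- replace (0 - 0)%C with (RtoC 0) by ring; rewrite Cmod_0; lra.
- induction n as [| n IH]; rewrite ?sum_O, ?sum_Sn, Hc; [symmetry; apply Cmult_0_l |].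
  rewrite <- IH, Cmult_0_l; symmetry; apply Cplus_0_l.
Qed.

Lemma analytic_at_minus (f g : C -> C) (z0 : C) :
  analytic_at f z0 -> analytic_at g z0 -> analytic_at (fun z => f z - g z)%C z0.
Proof.
intros [c [r Hf]] [d [r' Hg]].
exists (fun k => c k - d k)%C, (mkposreal _ (Rmin_stable_in_posreal r r')).
intros z Hz; simpl in Hz.
specialize (Hf z (Rlt_le_trans _ _ _ Hz (Rmin_l _ _))).
specialize (Hg z (Rlt_le_trans _ _ _ Hz (Rmin_r _ _))).
rewrite is_pseries_Cpow in Hf, Hg |- *.
eapply is_series_ext; [| exact (is_series_minus _ _ _ _ Hf Hg)].
intros k; change (c k * (z - z0) ^ k - d k * (z - z0) ^ k = (c k - d k) * (z - z0) ^ k)%C.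
ring.
Qed.

(** Along a segment the set of parameters up to which [f] vanishes in a
    neighbourhood is closed because zeros are isolated, and open. *)
Lemma identity_on_segment (f : C -> C) (p s : C) :
  (forall t, 0 <= t <= 1 -> analytic_at f (p + t * (s - p))%C) ->
  (exists r, 0 < r /\ forall z, Cmod (z - p) < r -> f z = 0) ->
  f s = 0.
Proof.
intros Ha H0.
destruct (Ceq_dec p s) as [<- | Hps].
{ destruct H0 as [r [Hr H]]; apply H.
  replace (p - p)%C with (RtoC 0) by ring; now rewrite Cmod_0. }
set (g := fun t : R => (p + t * (s - p))%C) in *.
assert (Hd : 0 < Cmod (s - p)).
{ apply Cmod_gt_0; intros E; apply Hps; replace s with (s - p + p)%C by ring.
  rewrite E; ring. }
set (d := Cmod (s - p)) in *.
assert (Hg : forall t u, Cmod (g t - g u) = Rabs (t - u) * d).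
{ intros t u; unfold g, d; rewrite <- Cmod_R, <- Cmod_mult; f_equal.
  rewrite RtoC_minus; ring. }
pose (P := fun t => exists r, 0 < r /\ forall z, Cmod (z - g t) < r -> f z = 0).
pose (E := fun t => 0 <= t <= 1 /\ forall u, 0 <= u <= t -> P u).
assert (P0 : P 0).
{ destruct H0 as [r Hr]; exists r.
  unfold g; now replace (p + 0 * (s - p))%C with p by ring. }
assert (E0 : E 0) by (split; [lra | intros u Hu; now replace u with 0 by lra]).
destruct (completeness E) as [m [Hub Hlub]].
{ exists 1; intros t [Ht _]; lra. }
{ now exists 0. }
assert (Hm0 : 0 <= m) by now apply Hub.
assert (Hm1 : m <= 1) by (apply Hlub; intros t [Ht _]; lra).
assert (Hlt : forall u, 0 <= u < m -> P u).
{ intros u Hu.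
  destruct (Classical_Prop.classic (P u)) as [H | H]; [exact H | exfalso].
  assert (m <= u); [| lra].
  apply Hlub; intros t [_ Ht].
  destruct (Rle_or_lt t u) as [Hle | Hl]; [exact Hle |].
  exfalso; apply H, Ht; lra. }
assert (Pm : P m).
{ destruct (Req_dec m 0) as [-> | Hne]; [exact P0 |].
  destruct (analytic_isolated_zeros f (g m)) as [r Hr].
  - apply Ha; lra.
  - intros eps He.
    assert (Hdel : 0 < Rmin m (eps / d)) by (apply Rmin_pos; [lra |]; now apply Rdiv_lt_0_compat).
    set (del := Rmin m (eps / d)) in *.
    assert (H1 : del <= m) by apply Rmin_l.
    assert (H2 : del <= eps / d) by apply Rmin_r.
    exists (g (m - del / 2)); split.
    + rewrite Hg; replace (m - del / 2 - m) with (- (del / 2)) by ring.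
      rewrite Rabs_Ropp, Rabs_pos_eq by lra; split.
      * apply Rmult_lt_0_compat; lra.
      * apply Rle_div_r in H2; [| exact Hd].
        assert (0 < del * d) by now apply Rmult_lt_0_compat.
        lra.
    + destruct (Hlt (m - del / 2)) as [r [Hr H]]; [lra |].
      apply H; rewrite Hg, Rminus_diag, Rabs_R0; lra.
  - now exists r. }
assert (m = 1) as ->.
{ destruct (Rle_lt_or_eq_dec m 1 Hm1) as [Hl | ->]; [exfalso | reflexivity].
  destruct Pm as [r [Hr H]].
  assert (Hstep : 0 < Rmin (1 - m) (r / (2 * d))).
  { apply Rmin_pos; [lra |]; apply Rdiv_lt_0_compat; lra. }
  set (e := Rmin (1 - m) (r / (2 * d))) in *.
  assert (He1 : e <= 1 - m) by apply Rmin_l.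
  assert (He2 : e * (2 * d) <= r) by (apply Rle_div_r; [lra | apply Rmin_r]).
  assert (Em : E (m + e)); [| specialize (Hub _ Em); lra].
  split; [lra |]; intros u Hu.
  destruct (Rlt_or_le u m) as [Hum | Hum]; [apply Hlt; lra |].
  exists (r / 2); split; [lra |]; intros z Hz; apply H.
  replace (z - g m)%C with ((z - g u) + (g u - g m))%C by ring.
  eapply Rle_lt_trans; [apply Cmod_triangle |]; rewrite Hg, Rabs_pos_eq by lra.
  assert ((u - m) * d <= e * d) by (apply Rmult_le_compat_r; lra).
  lra. }
destruct Pm as [r [Hr H]]; apply H; unfold g.
replace (s - (p + 1 * (s - p)))%C with (RtoC 0) by ring; now rewrite Cmod_0.
Qed.

(** Two continuations agree: from [s] run diagonally to the half-plane of
    convergence, away from the real axis so as to avoid the point [1]. *)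
Lemma hurwitz_continuation_unique (a sigma sigma' : R) (Z Z' : C -> C) (s : C) :
  hurwitz_continuation a sigma Z -> hurwitz_continuation a sigma' Z' ->
  sigma < Re s -> sigma' < Re s -> s <> RtoC 1 -> Z s = Z' s.
Proof.
intros [Ha Hs] [Ha' Hs'] H H' Hs1.
enough (E : (Z s - Z' s = 0)%C)
  by (replace (Z s) with (Z s - Z' s + Z' s)%C by ring; rewrite E; ring).
set (K := 2 + Rabs (Re s)).
assert (HK : 2 <= K /\ 2 <= Re s + K).
{ unfold K; assert (Hp := Rabs_pos (Re s)).
  assert (Hq := Rabs_le_between (Re s) (Rabs (Re s))).
  destruct Hq as [Hq _]; specialize (Hq (Rle_refl _)); lra. }
assert (HK' : exists K', (K' = K /\ 0 <= Im s) \/ (K' = - K /\ Im s < 0)).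
{ destruct (Rle_or_lt 0 (Im s)); [exists K | exists (- K)]; tauto. }
destruct HK' as [K' HK'].
apply (identity_on_segment (fun z => Z z - Z' z)%C (s + (K, K'))%C s).
- intros t Ht.
  replace (s + (K, K') + t * (s - (s + (K, K'))))%C
    with (Re s + (1 - t) * K, Im s + (1 - t) * K')
    by (destruct s as [x y]; apply injective_projections; simpl; ring).
  set (g := (_, _)).
  assert (Hg : Re s <= Re g) by (unfold g; simpl; nra).
  assert (Hg1 : g <> RtoC 1).
  { intros E; apply Hs1; unfold g in E; injection E as E1 E2.
    assert (Et : t = 1) by (destruct HK' as [[-> Hi] | [-> Hi]]; nra).
    subst t; destruct s as [x y]; simpl in *.
    apply injective_projections; simpl; lra. }
  apply analytic_at_minus; [apply Ha | apply Ha']; auto; lra.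
- exists 1; split; [lra |]; intros z Hz.
  assert (Hz1 : 1 < Re z).
  { assert (Hr := re_le_Cmod (z - (s + (K, K')))%C).
    apply Rabs_le_between in Hr.
    destruct z as [x y], s as [x' y']; simpl in *; lra. }
  rewrite (is_Cseries_inj _ _ _ (Hs z Hz1) (Hs' z Hz1)); ring.
Qed.

(** * The Hurwitz zeta function on the half-plane [0 < Re z] *)

Lemma Rcpow_cexp (x : R) (z : C) : Rcpow x z = cexp (z * RtoC (ln x)).
Proof.
destruct z as [u v]; unfold Rcpow, cexp; simpl.
now replace (u * ln x - v * 0) with (u * ln x) by ring;
  replace (u * 0 + v * ln x) with (v * ln x) by ring.
Qed.

Lemma Cmod_Rcpow (x : R) (z : C) : Cmod (Rcpow x z) = Rpower x (Re z).
Proof.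
rewrite Rcpow_cexp, Cmod_cexp; unfold Rpower; f_equal.
destruct z as [u v]; simpl; ring.
Qed.

Lemma Rcpow_add (x : R) (z w : C) : Rcpow x (z + w) = (Rcpow x z * Rcpow x w)%C.
Proof. rewrite !Rcpow_cexp, <- cexp_add; f_equal; ring. Qed.

Lemma Rcpow_1 (x : R) : 0 < x -> Rcpow x 1 = RtoC x.
Proof.
intros Hx; rewrite Rcpow_cexp, Cmult_1_l, cexp_RtoC; f_equal; now apply exp_ln.
Qed.

(** The increment of [(z - 1) sum_(n < N) (n + a)^-z + (N + a)^(1 - z)], which
    is [z - 1] times the error of replacing [b^-z] by its integral over
    [b, b+1]. *)
Definition zeta_term (b : R) (z : C) : C :=
  ((z - 1) * Rcpow b (- z) - Rcpow b (1 - z) + Rcpow (b + 1) (1 - z))%C.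

Lemma ln_succ_bounds (b : R) : 1 <= b ->
  / (b + 1) <= ln (b + 1) - ln b <= / b.
Proof.
intros Hb; rewrite <- ln_div by lra.
assert (Hlog : forall x, 0 < x -> ln x <= x - 1).
{ intros x Hx; assert (H := exp_ineq1_le (ln x)); rewrite exp_ln in H; lra. }
split.
- assert (H := Hlog (b / (b + 1))).
  replace ((b + 1) / b) with (/ (b / (b + 1))) by (field; lra).
  assert (H0 : 0 < b / (b + 1)) by (apply Rdiv_lt_0_compat; lra).
  rewrite ln_Rinv by exact H0; specialize (H H0).
  replace (b / (b + 1)) with (1 - / (b + 1)) in * by (field; lra); lra.
- assert (H := Hlog ((b + 1) / b) ltac:(apply Rdiv_lt_0_compat; lra)).
  replace ((b + 1) / b) with (1 + / b) in * by (field; lra); lra.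
Qed.

(** Since [(b + 1)^(1-z) = b^(1-z) exp v], the linear term [v] cancels against
    [(1 - z) b^(-z)] up to the difference of [e] and [/ b]. *)
Lemma zeta_term_eq (b : R) (z : C) : 0 < b ->
  let e := ln (b + 1) - ln b in
  let v := (RtoC e * (1 - z))%C in
  zeta_term b z = (Rcpow b (1 - z) *
    ((cexp v - 1 - v) + RtoC (e - / b) * (1 - z)))%C.
Proof.
intros Hb e v; unfold zeta_term.
replace (Rcpow (b + 1) (1 - z)) with (Rcpow b (1 - z) * cexp v)%C.
2: { rewrite !Rcpow_cexp, <- cexp_add; f_equal; unfold v, e.
     rewrite RtoC_minus; ring. }
replace (Rcpow b (- z)) with (Rcpow b (1 - z) * RtoC (/ b))%C.
- unfold v; rewrite RtoC_minus; ring.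
- replace (- z)%C with ((1 - z) + - (1))%C by ring.
  rewrite Rcpow_add; f_equal; rewrite Rcpow_cexp.
  replace (- (1) * RtoC (ln b))%C with (RtoC (- ln b)) by (rewrite RtoC_opp; ring).
  rewrite cexp_RtoC, exp_Ropp, exp_ln; auto.
Qed.

Lemma power_sum_Rcpow (r b : R) (z0 : C) : 0 < r -> 1 <= b ->
  power_sum r (Rpower b (1 - Re z0 + r)) (fun w => Rcpow b (1 - (z0 + w))).
Proof.
intros Hr Hb.
assert (Hl : 0 <= ln b) by (rewrite <- ln_1; apply ln_le; lra).
apply (power_sum_ext r _
  (fun w => Rcpow b (1 - z0) * cexp (0 + - RtoC (ln b) * w))%C).
- intros w _; rewrite !Rcpow_cexp, <- cexp_add; f_equal; ring.
- rewrite Rpower_plus.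
  replace (Rpower b (1 - Re z0)) with (Cmod (Rcpow b (1 - z0)))
    by (rewrite Cmod_Rcpow; f_equal; destruct z0; simpl; ring).
  apply power_sum_scal; unfold Rpower.
  replace (r * ln b) with (Cmod 0 + Cmod (- RtoC (ln b)) * r)
    by (rewrite Cmod_0, Cmod_opp, Cmod_R, Rabs_pos_eq by exact Hl; ring).
  now apply power_sum_cexp, power_sum_affine.
Qed.

(** The factor [b^(1-z)] costs [b^(1 - Re z0 + r)], and the second-order
    cancellation in the other factor gains [b^(-2)]. *)
Lemma power_sum_zeta_term (r b : R) (z0 : C) : 0 < r -> 1 <= b ->
  let K := Cmod (1 - z0) + r in
  power_sum r ((K ^ 2 * exp K + K) * Rpower b (- 1 - (Re z0 - r)))
    (fun w => zeta_term b (z0 + w)).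
Proof.
intros Hr Hb K.
destruct (ln_succ_bounds b Hb) as [He1 He2].
set (e := ln (b + 1) - ln b) in *.
assert (HK : 0 <= K) by (unfold K; assert (H := Cmod_ge_0 (1 - z0)); lra).
assert (Hb1 : 0 < / (b + 1)) by (apply Rinv_0_lt_compat; lra).
assert (Hib : 0 < / b <= 1).
{ split; [apply Rinv_0_lt_compat; lra |].
  rewrite <- Rinv_1; apply Rinv_le_contravar; lra. }
assert (Hlin : power_sum r K (fun w => 1 - (z0 + w))%C).
{ apply (power_sum_ext r _ (fun w => (1 - z0) + - (1) * w)%C); [intros; ring |].
  replace K with (Cmod (1 - z0) + Cmod (- (1)) * r)
    by (rewrite Cmod_opp, Cmod_1; unfold K; ring).
  now apply power_sum_affine. }
assert (Hv : power_sum r (/ b * K) (fun w => RtoC e * (1 - (z0 + w)))%C).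
{ apply power_sum_le with (Cmod e * K); [| now apply power_sum_scal].
  rewrite Cmod_R, Rabs_pos_eq by lra; now apply Rmult_le_compat_r. }
assert (Hd : power_sum r ((/ b) ^ 2 * K) (fun w => RtoC (e - / b) * (1 - (z0 + w)))%C).
{ apply power_sum_le with (Cmod (RtoC (e - / b)) * K); [| now apply power_sum_scal].
  apply Rmult_le_compat_r; [exact HK |]; rewrite Cmod_R, Rabs_left1 by lra.
  apply Rle_trans with (/ b - / (b + 1)); [lra |].
  replace (/ b - / (b + 1)) with (/ b * / (b + 1)) by (field; lra).
  simpl; rewrite Rmult_1_r; apply Rmult_le_compat_l; [lra |].
  apply Rinv_le_contravar; lra. }
apply (power_sum_ext r _ (fun w => Rcpow b (1 - (z0 + w)) *
  ((cexp (RtoC e * (1 - (z0 + w))) - 1 - RtoC e * (1 - (z0 + w))) +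
   RtoC (e - / b) * (1 - (z0 + w))))%C).
{ intros w _; symmetry; apply zeta_term_eq; lra. }
replace (- 1 - (Re z0 - r)) with (1 - Re z0 + r + - (2)) by ring.
rewrite Rpower_plus, Rpower_Ropp, Rmult_comm, Rmult_assoc.
apply power_sum_mult; [exact Hr | now apply power_sum_Rcpow |].
apply power_sum_le with ((/ b * K) ^ 2 * exp (/ b * K) + (/ b) ^ 2 * K).
- assert (E2 : Rpower b 2 = b ^ 2)
    by (change 2 with (INR 2) at 1; apply Rpower_pow; lra).
  rewrite E2, <- pow_inv.
  rewrite Rpow_mult_distr, Rmult_plus_distr_l.
  apply Rplus_le_compat_r; rewrite Rmult_assoc.
  apply Rmult_le_compat_l; [apply pow_le; lra |].
  apply Rmult_le_compat_l; [now apply pow_le |].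
  destruct (Rle_lt_or_eq_dec (/ b * K) K) as [H | ->]; [nra | | apply Rle_refl].
  now apply Rlt_le, exp_increasing.
- apply power_sum_plus; [| exact Hd | lra].
  now apply power_sum_cexp_remainder.
Qed.

(** Telescoping: [b^(-d) - (b+1)^(-d) >= d (b+1)^(-1-d)], and [b + 1 <= 2 b]. *)
Lemma ex_series_Rpower (a d : R) : 1 <= a -> 0 < d ->
  exists m, is_series (fun n => Rpower (INR n + a) (- 1 - d)) m.
Proof.
intros Ha Hd.
set (C := Rpower 2 (1 + d) / d).
assert (HC : 0 < C) by (apply Rdiv_lt_0_compat; [apply exp_pos | exact Hd]).
assert (Hb : forall n, 1 <= INR n + a) by (intros n; assert (H := pos_INR n); lra).
assert (Hstep : forall b, 1 <= b ->
  Rpower b (- 1 - d) <= C * (Rpower b (- d) - Rpower (b + 1) (- d))).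
{ intros b Hb1; destruct (ln_succ_bounds b Hb1) as [He _].
  set (e := ln (b + 1) - ln b) in *.
  assert (H1 : d * / (b + 1) * Rpower (b + 1) (- d) <= Rpower b (- d) - Rpower (b + 1) (- d)).
  { replace (Rpower b (- d)) with (exp (d * e) * Rpower (b + 1) (- d)).
    - assert (H := exp_ineq1_le (d * e)).
      assert (Hp : 0 < Rpower (b + 1) (- d)) by apply exp_pos.
      assert (d * / (b + 1) <= d * e) by (apply Rmult_le_compat_l; lra).
      nra.
    - unfold Rpower, e; rewrite <- exp_plus; f_equal; ring. }
  apply Rle_trans with (C * (d * / (b + 1) * Rpower (b + 1) (- d)));
    [| apply Rmult_le_compat_l; lra].
  replace (C * (d * / (b + 1) * Rpower (b + 1) (- d)))
    with (Rpower 2 (1 + d) * Rpower (b + 1) (- 1 - d)).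
  - replace (- 1 - d) with (- (1 + d)) by ring; rewrite !Rpower_Ropp.
    replace (Rpower 2 (1 + d) * / Rpower (b + 1) (1 + d))
      with (/ (Rpower (b + 1) (1 + d) * / Rpower 2 (1 + d))).
    + apply Rinv_le_contravar.
      * apply Rmult_lt_0_compat; [| apply Rinv_0_lt_compat]; apply exp_pos.
      * apply Rle_div_l; [apply exp_pos |].
        rewrite Rpower_mult_distr by lra; apply Rle_Rpower_l; lra.
    + field; split; apply Rgt_not_eq, exp_pos.
  - replace (- 1 - d) with (- (1) + - d) by ring.
    rewrite (Rpower_plus (- (1)) (- d)), (Rpower_Ropp _ 1), Rpower_1 by lra.
    unfold C; field; lra. }
destruct (ex_series_bounded (fun n => Rpower (INR n + a) (- 1 - d))
  (C * Rpower a (- d))) as [m [Hm _]]; [| | now exists m].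
- intros k; apply Rlt_le, exp_pos.
- intros n; apply Rle_trans with (C * (Rpower a (- d) - Rpower (INR (S n) + a) (- d))).
  + induction n as [| n IH]; rewrite ?sum_O, ?sum_Sn.
    * assert (H := Hstep a Ha); simpl INR; now rewrite Rplus_0_l, (Rplus_comm 1).
    * assert (H := Hstep _ (Hb (S n))); rewrite (S_INR (S n)).
      replace (INR (S n) + 1 + a) with (INR (S n) + a + 1) by ring.
      change (sum_n (fun n => Rpower (INR n + a) (- 1 - d)) n +
        Rpower (INR (S n) + a) (- 1 - d) <=
        C * (Rpower a (- d) - Rpower (INR (S n) + a + 1) (- d))); lra.
  + assert (0 < Rpower (INR (S n) + a) (- d)) by apply exp_pos; nra.
Qed.

Lemma Rpower_neg_lt_far (p eps y : R) : 0 < p -> 0 < eps ->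
  exp (- ln eps / p) < y -> Rpower y (- p) < eps.
Proof.
intros Hp He Hy; unfold Rpower.
rewrite <- (exp_ln eps He) at 1; apply exp_increasing.
apply ln_increasing in Hy; [| apply exp_pos]; rewrite ln_exp in Hy.
apply Rlt_div_l in Hy; [lra | exact Hp].
Qed.

Lemma Rpower_neg_to_0 (a d eps : R) : 0 < a -> 0 < d -> 0 < eps ->
  exists N, forall n, (N <= n)%nat -> Rpower (INR n + a) (- d) < eps.
Proof.
intros Ha Hd He.
destruct (INR_unbounded (exp (- ln eps / d))) as [N HN].
exists N; intros n Hn; assert (Hn' := le_INR _ _ Hn).
apply Rpower_neg_lt_far; auto; lra.
Qed.

Definition zeta_term_sum (a : R) (z : C) : C :=
  iota (T := C_CompleteNormedModule)
    (fun l => is_Cseries (fun n => zeta_term (INR n + a) z) l).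

Lemma zeta_term_sum_correct (a : R) (z : C) : 1 <= a -> 0 < Re z ->
  is_Cseries (fun n => zeta_term (INR n + a) z) (zeta_term_sum a z).
Proof.
intros Ha Hz.
apply (iota_correct (K := C_AbsRing) (V := C_CompleteNormedModule)
  (fun l => is_Cseries (fun n => zeta_term (INR n + a) z) l)).
destruct (ex_series_Rpower a (Re z - Re z / 2) Ha ltac:(lra)) as [m Hm].
destruct (ex_Cseries_le (fun n => zeta_term (INR n + a) z)
  (fun n => let K := Cmod (1 - z) + Re z / 2 in
     (K ^ 2 * exp K + K) * Rpower (INR n + a) (- 1 - (Re z - Re z / 2)))) as [l Hl].
- intros n.
  assert (Hb : 1 <= INR n + a) by (assert (H := pos_INR n); lra).
  assert (H := power_sum_zeta_term (Re z / 2) (INR n + a) z ltac:(lra) Hb).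
  apply (power_sum_bound _ _ _ 0) in H; [| rewrite Cmod_0; lra].
  cbv beta in H; now rewrite Cplus_0_r in H.
- eexists; apply (is_series_scal (K := R_AbsRing) (V := R_NormedModule)); exact Hm.
- exists l; split; [exact Hl |]; intros l' Hl'; exact (is_Cseries_inj _ _ _ Hl Hl').
Qed.

Lemma zeta_term_partial_sum (a : R) (z : C) (n : nat) :
  Csum (fun n => zeta_term (INR n + a) z) n =
  ((z - 1) * Csum (fun n => Rcpow (INR n + a) (- z)) n
   - Rcpow a (1 - z) + Rcpow (INR (S n) + a) (1 - z))%C.
Proof.
induction n as [| n IH]; rewrite ?sum_O, ?sum_Sn.
- unfold zeta_term; simpl INR; now rewrite Rplus_0_l, (Rplus_comm 1).
- rewrite IH, (S_INR (S n)).
  replace (INR (S n) + 1 + a) with (INR (S n) + a + 1) by ring.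
  unfold zeta_term; set (S0 := Csum _ n).
  change (((z - 1) * S0 - Rcpow a (1 - z) + Rcpow (INR (S n) + a) (1 - z)) +
    ((z - 1) * Rcpow (INR (S n) + a) (- z) - Rcpow (INR (S n) + a) (1 - z) +
     Rcpow (INR (S n) + a + 1) (1 - z)) =
    (z - 1) * (S0 + Rcpow (INR (S n) + a) (- z)) - Rcpow a (1 - z) +
      Rcpow (INR (S n) + a + 1) (1 - z))%C; ring.
Qed.

(** On [0 < Re z] this is [(z - 1) zeta(z, a)]; it is regular at [z = 1]. *)
Definition zeta_reg (a : R) (z : C) : C := (Rcpow a (1 - z) + zeta_term_sum a z)%C.

Lemma Re_ge_sub (z0 w : C) (r : R) : Cmod w <= r -> Re z0 - r <= Re (z0 + w).
Proof.
intros H; assert (Hw := re_le_Cmod w); apply Rabs_le_between in Hw.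
destruct z0, w; simpl in *; lra.
Qed.

Lemma zeta_reg_continuation (a : R) : 1 <= a ->
  hurwitz_continuation a 0 (fun z => zeta_reg a z / (z - 1))%C.
Proof.
intros Ha; split.
- intros z0 Hz0 Hz1.
  assert (Hz1' : 0 < Cmod (z0 - 1)).
  { apply Cmod_gt_0; intros E; apply Hz1; replace z0 with (z0 - 1 + 1)%C by ring.
    rewrite E; ring. }
  set (r := Rmin (Re z0 / 2) (Cmod (z0 - 1) / 2)).
  assert (Hr : 0 < r) by (apply Rmin_pos; lra).
  assert (Hr1 : r <= Re z0 / 2) by apply Rmin_l.
  assert (Hr2 : r <= Cmod (z0 - 1) / 2) by apply Rmin_r.
  destruct (ex_series_Rpower a (Re z0 - r) Ha ltac:(lra)) as [m Hm].
  eapply (power_sum_analytic r); [exact Hr |].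
  apply (power_sum_ext r _ (fun w => (Rcpow a (1 - (z0 + w)) + zeta_term_sum a (z0 + w)) *
    / ((z0 - 1) + w))%C).
  { intros w _; unfold zeta_reg, Cdiv; do 2 f_equal; ring. }
  apply power_sum_mult; [exact Hr | | apply power_sum_inv_affine; lra].
  apply power_sum_plus; [now apply power_sum_Rcpow | | lra].
  eapply power_sum_series with (f := fun n w => zeta_term (INR n + a) (z0 + w)); [exact Hr | | |].
  + apply (is_series_scal (K := R_AbsRing) (V := R_NormedModule)); exact Hm.
  + intros n; apply power_sum_zeta_term; [exact Hr |].
    assert (H := pos_INR n); lra.
  + intros w Hw; apply zeta_term_sum_correct; [exact Ha |].
    assert (H := Re_ge_sub z0 w r Hw); lra.
- intros z Hz.
  assert (Hne : (z - 1 <> 0)%C).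
  { intros E; replace z with (z - 1 + 1)%C in Hz by ring.
    rewrite E in Hz; simpl in Hz; lra. }
  assert (Hm : 0 < Cmod (z - 1)) by now apply Cmod_gt_0.
  assert (Hs := zeta_term_sum_correct a z Ha ltac:(lra)).
  rewrite is_Cseries_iff in Hs |- *; intros eps He.
  assert (He' : 0 < eps * Cmod (z - 1) / 2) by (apply Rdiv_lt_0_compat; [| lra]; now apply Rmult_lt_0_compat).
  destruct (Hs _ He') as [N HN].
  destruct (Rpower_neg_to_0 a (Re z - 1) _ ltac:(lra) ltac:(lra) He') as [N' HN'].
  exists (max N N'); intros n Hn.
  specialize (HN n ltac:(lia)); specialize (HN' (S n) ltac:(lia)).
  rewrite zeta_term_partial_sum in HN.
  set (S0 := Csum _ n) in *.
  replace (S0 - zeta_reg a z / (z - 1))%C with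
    ((((z - 1) * S0 - Rcpow a (1 - z) + Rcpow (INR (S n) + a) (1 - z) - zeta_term_sum a z)
      + - Rcpow (INR (S n) + a) (1 - z)) / (z - 1))%C
    by (unfold zeta_reg; field; exact Hne).
  rewrite Cmod_div by exact Hne; apply Rlt_div_l; [exact Hm |].
  eapply Rle_lt_trans; [apply Cmod_triangle |].
  rewrite Cmod_opp, Cmod_Rcpow.
  replace (Re (1 - z)) with (- (Re z - 1)) by (destruct z; simpl; ring); lra.
Qed.

Lemma hurwitz_zeta_eq (a : R) (s : C) : 1 <= a -> 0 < Re s -> s <> RtoC 1 ->
  hurwitz_zeta s a = (zeta_reg a s / (s - 1))%C.
Proof.
intros Ha Hs Hs1.
apply (iota_unique (K := C_AbsRing) (V := C_CompleteNormedModule)).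
- intros w [sigma [Z [Hsigma [HZ ->]]]].
  exact (hurwitz_continuation_unique a sigma 0 Z _ s HZ (zeta_reg_continuation a Ha) Hsigma Hs Hs1).
- exists 0, (fun z => zeta_reg a z / (z - 1))%C; split; [exact Hs |]; split; [| reflexivity].
  now apply zeta_reg_continuation.
Qed.

(** * Improper integrals on the positive half-line *)

Local Notation is_CRInt_pos := (is_RInt_pos (V := C_R_NormedModule)).

Lemma at_right_0_intro (P : R -> Prop) (d : R) :
  0 < d -> (forall x, 0 < x < d -> P x) -> at_right 0 P.
Proof.
intros Hd H; exists (mkposreal d Hd); intros x Hx Hx0.
apply H; split; [exact Hx0 |].
unfold ball in Hx; simpl in Hx; unfold AbsRing_ball, abs, minus, plus, opp in Hx; simpl in Hx.
rewrite Ropp_0, Rplus_0_r in Hx; apply Rabs_def2 in Hx; lra.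
Qed.

Lemma at_right_0_pos : at_right 0 (fun x => 0 < x).
Proof. apply (at_right_0_intro _ 1); [lra | intros x Hx; lra]. Qed.

Lemma p_infty_pos : Rbar_locally p_infty (fun x => 0 < x).
Proof. now exists 0. Qed.

Lemma is_RInt_pos_ext {V : NormedModule R_AbsRing} (f g : R -> V) (l : V) :
  (forall x, 0 < x -> f x = g x) -> is_RInt_pos f l -> is_RInt_pos g l.
Proof.
intros H; apply is_RInt_gen_ext.
eapply Filter_prod; [exact at_right_0_pos | exact p_infty_pos |].
intros x y Hx Hy z Hz; apply H; simpl in Hz.
assert (0 < Rmin x y) by now apply Rmin_pos.
lra.
Qed.

Lemma is_RInt_pos_derive {V : CompleteNormedModule R_AbsRing} (F f : R -> V) (l0 l1 : V) :
  (forall x, 0 < x -> is_derive F x (f x)) ->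
  (forall x, 0 < x -> continuous f x) ->
  filterlim F (at_right 0) (locally l0) ->
  filterlim F (Rbar_locally p_infty) (locally l1) ->
  is_RInt_pos f (minus l1 l0).
Proof.
intros HF Hf H0 H1.
assert (Hlim : filterlim (fun ab => minus (F (snd ab)) (F (fst ab)))
  (filter_prod (at_right 0) (Rbar_locally p_infty)) (locally (minus l1 l0))).
{ assert (HA : filterlim (fun ab : R * R => F (fst ab))
    (filter_prod (at_right 0) (Rbar_locally p_infty)) (locally l0))
    by exact (filterlim_comp _ _ _ fst F _ _ _ filterlim_fst H0).
  assert (HB : filterlim (fun ab : R * R => F (snd ab))
    (filter_prod (at_right 0) (Rbar_locally p_infty)) (locally l1))
    by exact (filterlim_comp _ _ _ snd F _ _ _ filterlim_snd H1).
  exact (filterlim_comp_2 _ (fun ab => opp (F (fst ab))) plus HB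
    (filterlim_comp _ _ _ _ opp _ _ _ HA (filterlim_opp l0))
    (filterlim_plus l1 (opp l0))). }
intros P HP; specialize (Hlim P HP); unfold filtermapi, filtermap in *.
assert (Hpos : filter_prod (at_right 0) (Rbar_locally p_infty)
  (fun ab => 0 < fst ab /\ 0 < snd ab)).
{ eapply Filter_prod; [exact at_right_0_pos | exact p_infty_pos |]; now split. }
generalize (filter_and _ _ Hlim Hpos); apply filter_imp.
intros [a b] [HPab [Ha Hb]]; simpl in *.
exists (minus (F b) (F a)); split; [| exact HPab].
assert (Hmin : 0 < Rmin a b) by now apply Rmin_pos.
apply is_RInt_derive; intros x Hx; [apply HF | apply Hf]; lra.
Qed.

Lemma Cball_intro (x y : C) (eps : R) :
  Cmod (y - x) < eps -> ball (x : C_R_NormedModule) eps y.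
Proof.
intros H; assert (Hm := Rmax_Cmod (y - x)%C); split.
- eapply Rle_lt_trans; [| exact H]; eapply Rle_trans; [apply Rmax_l | exact Hm].
- eapply Rle_lt_trans; [| exact H]; eapply Rle_trans; [apply Rmax_r | exact Hm].
Qed.

(** Absolute convergence, with the majorant given by its antiderivative [G]:
    the primitive of [f] inherits the Cauchy criterion of [G] at both ends. *)
Lemma is_CRInt_pos_dominated (f : R -> C) (G g : R -> R) (l0 l1 : R) :
  (forall x, 0 < x -> Ccontinuous f x) ->
  (forall x, 0 < x -> is_derive G x (g x)) ->
  (forall x, 0 < x -> continuous g x) ->
  (forall x, 0 < x -> Cmod (f x) <= g x) ->
  filterlim G (at_right 0) (locally l0) ->
  filterlim G (Rbar_locally p_infty) (locally l1) ->
  exists l : C, is_CRInt_pos f l /\ Cmod l <= l1 - l0.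
Proof.
intros Hf HG Hg Hfg H0 H1.
set (F := fun x => RInt (V := C_R_CompleteNormedModule) f 1 x).
assert (HF : forall x, 0 < x -> is_Cderive F x (f x)).
{ intros x Hx; apply (is_derive_RInt (V := C_R_NormedModule) f F 1 x); [| now apply Hf].
  exists (mkposreal x Hx); intros y Hy.
  assert (Hy0 : 0 < y).
  { unfold ball in Hy; simpl in Hy; unfold AbsRing_ball, abs, minus, plus, opp in Hy.
    simpl in Hy; apply Rabs_def2 in Hy; lra. }
  apply (RInt_correct (V := C_R_CompleteNormedModule)), (ex_RInt_continuous (V := C_R_CompleteNormedModule)).
  intros z Hz; apply Hf; assert (0 < Rmin 1 y) by (apply Rmin_pos; lra); lra. }
assert (Hinc : forall x y, 0 < x -> 0 < y -> Cmod (F y - F x) <= Rabs (G y - G x)).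
{ assert (Hle : forall x y, 0 < x -> x <= y -> Cmod (F y - F x) <= Rabs (G y - G x)).
  { intros x y Hx Hxy; eapply Rle_trans; [| apply Rle_abs].
    apply (Cderive_bound F f G g); auto; intros z Hz;
      [apply HF | apply Hf | apply HG | apply Hg | apply Hfg]; lra. }
  intros x y Hx Hy; destruct (Rle_or_lt x y) as [Hxy | Hxy]; auto.
  rewrite Cmod_minus_sym, Rabs_minus_sym; apply Hle; lra. }
assert (Hcauchy : forall (Fi : (R -> Prop) -> Prop) (l : R), ProperFilter Fi ->
  Fi (fun x => 0 < x) -> filterlim G Fi (locally l) ->
  exists m : C_R_CompleteNormedModule, filterlim F Fi (locally m)).
{ intros Fi l PF Hpos Hl.
  apply (filterlim_locally_cauchy (U := C_R_CompleteNormedModule)).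
  intros eps.
  destruct (proj2 (filterlim_locally_cauchy (U := R_CompleteSpace) (F := Fi) G)
    (ex_intro _ l Hl) eps) as [P [HP HPeps]].
  exists (fun x => P x /\ 0 < x); split; [now apply filter_and |].
  intros u v [Hu Hu0] [Hv Hv0]; apply Cball_intro.
  eapply Rle_lt_trans; [now apply Hinc |]; exact (HPeps u v Hu Hv). }
destruct (Hcauchy _ l0 _ at_right_0_pos H0) as [m0 Hm0].
destruct (Hcauchy _ l1 _ p_infty_pos H1) as [m1 Hm1].
exists (minus m1 m0).
assert (Hi := is_RInt_pos_derive (V := C_R_CompleteNormedModule) F f m0 m1 HF Hf Hm0 Hm1).
split; [exact Hi |].
assert (Hj := is_RInt_pos_derive (V := R_CompleteNormedModule) G g l0 l1 HG Hg H0 H1).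
rewrite Cmod_norm.
apply (RInt_gen_norm (V := C_R_CompleteNormedModule) (Fa := at_right 0) (Fb := Rbar_locally p_infty) f g); auto.
- apply (Filter_prod _ _ _ (fun x => x < 1) (fun y => 1 < y)).
  + apply (at_right_0_intro _ 1); [lra | intros x Hx; lra].
  + now exists 1.
  + intros x y Hx Hy; simpl; lra.
- eapply Filter_prod; [exact at_right_0_pos | exact p_infty_pos |].
  intros x y Hx Hy z Hz; simpl in Hz; rewrite <- Cmod_norm; apply Hfg; lra.
Qed.

Lemma is_CRInt_pos_Cmult (c : C) (f : R -> C) (l : C) :
  is_CRInt_pos f l -> is_CRInt_pos (fun x => c * f x)%C (c * l)%C.
Proof.
intros Hf P HP.
assert (Hc := filterlim_scal_r (K := C_AbsRing) (V := C_NormedModule) c l P HP).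
specialize (Hf _ Hc); unfold filtermapi in *; revert Hf.
apply filter_imp; intros [a b] [y [Hy HPy]]; simpl in *.
exists (c * y)%C; split; [| exact HPy].
assert (H1 := is_RInt_fct_extend_fst (U := R_NormedModule) (V := R_NormedModule) f a b y Hy).
assert (H2 := is_RInt_fct_extend_snd (U := R_NormedModule) (V := R_NormedModule) f a b y Hy).
apply (is_RInt_fct_extend_pair (U := R_NormedModule) (V := R_NormedModule)).
- apply (is_RInt_minus (V := R_NormedModule) (fun t => Re c * fst (f t)) (fun t => Im c * snd (f t))
    a b (Re c * fst y) (Im c * snd y)); now apply (is_RInt_scal (V := R_NormedModule)).
- apply (is_RInt_plus (V := R_NormedModule) (fun t => Re c * snd (f t)) (fun t => Im c * fst (f t))
    a b (Re c * snd y) (Im c * fst y)); now apply (is_RInt_scal (V := R_NormedModule)).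
Qed.

Lemma is_CRInt_pos_plus (f g : R -> C) (l m : C) :
  is_CRInt_pos f l -> is_CRInt_pos g m -> is_CRInt_pos (fun x => f x + g x)%C (l + m)%C.
Proof. apply (is_RInt_gen_plus (V := C_R_NormedModule)). Qed.

Lemma is_CRInt_pos_inj (f : R -> C) (l m : C) :
  is_CRInt_pos f l -> is_CRInt_pos f m -> l = m.
Proof.
intros Hl Hm.
rewrite <- (is_RInt_gen_unique (V := C_R_CompleteNormedModule) _ _ Hl).
exact (is_RInt_gen_unique (V := C_R_CompleteNormedModule) _ _ Hm).
Qed.

Lemma is_CRInt_pos_scaling (k : R) (f : R -> C) (l : C) : 0 < k ->
  is_CRInt_pos f l -> is_CRInt_pos (fun x => RtoC k * f (k * x)%R)%C l.
Proof.
intros Hk Hf.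
assert (Hlim : filterlim (fun ab : R * R => (k * fst ab, k * snd ab))
  (filter_prod (at_right 0) (Rbar_locally p_infty))
  (filter_prod (at_right 0) (Rbar_locally p_infty))).
{ apply filterlim_pair.
  - eapply filterlim_comp; [apply filterlim_fst |].
    intros P [d Hd]; apply (at_right_0_intro _ (d / k)).
    + apply Rdiv_lt_0_compat; [apply cond_pos | exact Hk].
    + intros x [Hx0 Hx]; apply Rlt_div_r in Hx; [| exact Hk].
      assert (Hkx : 0 < k * x) by now apply Rmult_lt_0_compat.
      apply Hd; [| exact Hkx].
      unfold ball; simpl; unfold AbsRing_ball, abs, minus, plus, opp; simpl.
      rewrite Ropp_0, Rplus_0_r, Rabs_pos_eq; lra.
  - eapply filterlim_comp; [apply filterlim_snd |].
    intros P [M HM]; exists (M / k); intros x Hx; apply HM.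
    apply Rlt_div_l in Hx; [| exact Hk]; lra. }
intros P HP; specialize (Hlim _ (Hf P HP)); unfold filtermapi, filtermap in *; revert Hlim.
apply filter_imp; intros [a b] [y [Hy HPy]]; simpl in *; exists y; split; [| exact HPy].
apply (is_RInt_ext (V := C_R_NormedModule)
  (fun x => scal k (f (k * x + 0) : C_R_NormedModule))).
- intros x _; rewrite Rplus_0_r.
  apply injective_projections; simpl; unfold scal; simpl; unfold mult; simpl; ring.
- apply (is_RInt_comp_lin (V := C_R_NormedModule)).
  now rewrite !Rplus_0_r.
Qed.

(** * Mellin transforms of exponentially decaying functions *)

(** Restates in [C] an equation typed in a normed module carried by [C], where
    [ring] finds no ring structure. *)
Local Ltac at_C := match goal with |- ?l = ?r => change (@eq C l r) end.

Lemma Rpower_lt_near_0 (p eps y : R) : 0 < p -> 0 < eps ->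
  0 < y < exp (ln eps / p) -> Rpower y p < eps.
Proof.
intros Hp He [Hy0 Hy]; unfold Rpower.
rewrite <- (exp_ln eps He) at 1; apply exp_increasing.
apply ln_increasing in Hy; [| exact Hy0]; rewrite ln_exp in Hy.
apply Rlt_div_r in Hy; [lra | exact Hp].
Qed.

(** This is [ln t <= t - 1] at [t = c x / p]. *)
Lemma Rpower_le_exp (p c x : R) : 0 < p -> 0 < c -> 0 < x ->
  Rpower x p <= Rpower (p / c) p * exp (c * x).
Proof.
intros Hp Hc Hx; unfold Rpower; rewrite <- exp_plus.
assert (Ht : 0 < c * x / p).
{ apply Rdiv_lt_0_compat; [now apply Rmult_lt_0_compat | exact Hp]. }
assert (Hl : ln x = ln (c * x / p) + ln (p / c)).
{ rewrite <- ln_mult; [f_equal; field; lra | exact Ht | now apply Rdiv_lt_0_compat]. }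
assert (H := exp_ineq1_le (ln (c * x / p))); rewrite exp_ln in H by exact Ht.
assert (Hle : p * ln x <= p * ln (p / c) + c * x).
{ rewrite Hl; replace (c * x) with (p * (c * x / p)) at 2 by (field; lra).
  assert (p * ln (c * x / p) <= p * (c * x / p)) by (apply Rmult_le_compat_l; lra).
  lra. }
destruct (Rle_lt_or_eq_dec _ _ Hle) as [H1 | ->]; [| apply Rle_refl].
now apply Rlt_le, exp_increasing.
Qed.

Lemma filterlim_R_intro {T : Type} (F : (T -> Prop) -> Prop) {FF : Filter F}
    (f : T -> R) (l : R) :
  (forall eps, 0 < eps -> F (fun x => Rabs (f x - l) < eps)) -> filterlim f F (locally l).
Proof.
intros H; apply filterlim_locally; intros eps.
exact (H eps (cond_pos eps)).
Qed.

Lemma filterlim_C_intro {T : Type} (F : (T -> Prop) -> Prop) {FF : Filter F}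
    (f : T -> C) (l : C) :
  (forall eps, 0 < eps -> F (fun x => Cmod (f x - l) < eps)) ->
  filterlim f F (locally (l : C_R_NormedModule)).
Proof.
intros H; apply filterlim_locally; intros eps.
generalize (H eps (cond_pos eps)); apply filter_imp.
intros x Hx; now apply Cball_intro.
Qed.

Lemma Ccontinuous_Rcpow (z : C) (x : R) : 0 < x -> Ccontinuous (fun x => Rcpow x z) x.
Proof.
intros Hx; apply Ccontinuous_iff; unfold Rcpow; simpl; split;
  apply (ex_derive_continuous (K := R_AbsRing) (V := R_NormedModule)); auto_derive; auto.
Qed.

Lemma Ccontinuous_RtoC (f : R -> R) (x : R) : ex_derive f x -> Ccontinuous (fun x => RtoC (f x)) x.
Proof.
intros Hf; apply Ccontinuous_iff; simpl; split; [| apply continuous_const].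
now apply (ex_derive_continuous (K := R_AbsRing) (V := R_NormedModule)).
Qed.

Definition exp_majorant (sigma A x : R) : R :=
  Rpower x (sigma - 1) * ((1 + A * x) * exp (- (A * x))).

(** The majorant is compared with the derivative of [- 1 / (1 + (A x)^sigma)],
    an increasing function with limits [-1] and [0]; the dependence on [A] is
    the homogeneity of the Mellin transform. *)
Lemma mellin_dominated (sigma : R) : 0 < sigma ->
  exists D, 0 < D /\ forall (A B : R) (f : R -> C), 0 < A -> 0 <= B ->
    (forall x, 0 < x -> Ccontinuous f x) ->
    (forall x, 0 < x -> Cmod (f x) <= B * exp_majorant sigma A x) ->
    exists l : C, is_CRInt_pos f l /\ Cmod l <= B * (D * Rpower A (- sigma)).
Proof.
intros Hs; set (M := Rpower (sigma / / 4) sigma).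
assert (HM : 0 < M) by apply exp_pos.
exists (2 * (1 + M) ^ 2 / sigma); split.
{ apply Rdiv_lt_0_compat; [| exact Hs]; apply Rmult_lt_0_compat; [lra |].
  apply pow_lt; lra. }
intros A B f HA HB Hf Hb.
assert (HAs : 0 < Rpower A (- sigma)) by apply exp_pos.
set (K := B * (2 * (1 + M) ^ 2 / sigma * Rpower A (- sigma))).
assert (HK : 0 <= K).
{ apply Rmult_le_pos; [exact HB |]; apply Rmult_le_pos; [| lra].
  apply Rlt_le, Rdiv_lt_0_compat; [| exact Hs]; apply Rmult_lt_0_compat; [lra |].
  apply pow_lt; lra. }
assert (HAx : forall x, 0 < x -> 0 < A * x) by (intros; now apply Rmult_lt_0_compat).
set (p := fun x => exp (sigma * ln (A * x))).
assert (Hp : forall x, 0 < p x) by (intros; apply exp_pos).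
replace K with (0 - - K) by ring.
apply (is_CRInt_pos_dominated f (fun x => K * - / (1 + p x))
  (fun x => K * (sigma * p x / x / (1 + p x) ^ 2))); [exact Hf | | | | |].
- intros x Hx; unfold p; specialize (Hp x); unfold p in Hp; specialize (HAx x Hx).
  auto_derive; [repeat split; lra |].
  field; repeat split; lra.
- intros x Hx; apply (ex_derive_continuous (K := R_AbsRing) (V := R_NormedModule)).
  unfold p; specialize (Hp x); unfold p in Hp; specialize (HAx x Hx).
  auto_derive; repeat split; try lra.
  rewrite Rmult_1_r; apply Rgt_not_eq, Rmult_lt_0_compat; lra.
- intros x Hx; eapply Rle_trans; [now apply Hb |]; unfold exp_majorant.
  set (y := A * x) in *; assert (Hy : 0 < y) by now apply HAx.
  replace (Rpower x (sigma - 1)) with (Rpower A (- sigma) * p x / x).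
  2: { unfold p, Rpower; rewrite ln_mult by lra.
       rewrite <- (exp_ln x) at 2 by exact Hx; unfold Rdiv.
       rewrite <- exp_Ropp, <- !exp_plus; f_equal; ring. }
  assert (Hkey : (1 + y) * exp (- y) * (1 + p x) ^ 2 <= 2 * (1 + M) ^ 2).
  { assert (H1 : p x <= M * exp (y / 4)).
    { replace (y / 4) with (/ 4 * y) by field.
      apply (Rpower_le_exp sigma (/ 4) y); lra. }
    assert (H2 : 1 + y <= 2 * exp (y / 2)) by (assert (H := exp_ineq1_le (y / 2)); lra).
    assert (H3 : 1 <= exp (y / 4)) by (assert (H := exp_ineq1_le (y / 4)); lra).
    assert (H4 : 1 + p x <= (1 + M) * exp (y / 4)) by lra.
    assert (H5 : (1 + p x) ^ 2 <= (1 + M) ^ 2 * exp (y / 2)).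
    { replace (exp (y / 2)) with (exp (y / 4) ^ 2)
        by (simpl; rewrite Rmult_1_r, <- exp_plus; f_equal; field).
      rewrite <- Rpow_mult_distr; apply pow_incr; specialize (Hp x); lra. }
    replace (2 * (1 + M) ^ 2) with
      ((2 * exp (y / 2)) * exp (- y) * ((1 + M) ^ 2 * exp (y / 2))).
    - apply Rmult_le_compat; [| apply pow2_ge_0 | | exact H5].
      + apply Rmult_le_pos; [lra | apply Rlt_le, exp_pos].
      + apply Rmult_le_compat_r; [apply Rlt_le, exp_pos | exact H2].
    - transitivity (2 * (1 + M) ^ 2 * (exp (y / 2) * exp (- y) * exp (y / 2))); [ring |].
      rewrite <- !exp_plus; replace (y / 2 + - y + y / 2) with 0 by field.
      rewrite exp_0; ring. }
  specialize (Hp x).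
  assert (Hq : 0 < (1 + p x) ^ 2) by (apply pow_lt; lra).
  assert (Hpx : 0 < Rpower A (- sigma) * p x / x).
  { apply Rdiv_lt_0_compat; [now apply Rmult_lt_0_compat | exact Hx]. }
  unfold K.
  replace (B * (2 * (1 + M) ^ 2 / sigma * Rpower A (- sigma)) * (sigma * p x / x / (1 + p x) ^ 2))
    with (B * (Rpower A (- sigma) * p x / x * (2 * (1 + M) ^ 2 / (1 + p x) ^ 2)))
    by (field; repeat split; lra).
  apply Rmult_le_compat_l; [exact HB |]; apply Rmult_le_compat_l; [lra |].
  exact (proj1 (Rle_div_r _ _ _ Hq) Hkey).
- apply (filterlim_R_intro _); intros eps He.
  assert (He' : 0 < eps / (K + 1)) by (apply Rdiv_lt_0_compat; lra).
  apply (at_right_0_intro _ (exp (ln (eps / (K + 1)) / sigma) / A)).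
  + apply Rdiv_lt_0_compat; [apply exp_pos | exact HA].
  + intros x [Hx0 Hx]; apply Rlt_div_r in Hx; [| exact HA].
    assert (H : p x < eps / (K + 1)).
    { apply Rpower_lt_near_0; auto; specialize (HAx x Hx0); lra. }
    specialize (Hp x).
    replace (K * - / (1 + p x) - - K) with (K * (p x / (1 + p x))) by (field; lra).
    assert (H0 : 0 <= p x / (1 + p x) <= p x).
    { split; [apply Rlt_le, Rdiv_lt_0_compat; lra |]; apply Rle_div_l; nra. }
    rewrite Rabs_pos_eq by (apply Rmult_le_pos; lra).
    apply Rlt_div_r in H; [| lra]; nra.
- apply (filterlim_R_intro _); intros eps He.
  assert (He' : 0 < eps / (K + 1)) by (apply Rdiv_lt_0_compat; lra).
  exists (exp (- ln (eps / (K + 1)) / sigma) / A); intros x Hx.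
  apply Rlt_div_l in Hx; [| exact HA].
  rewrite Rmult_comm in Hx; apply Rpower_neg_lt_far in Hx; [| exact Hs | exact He'].
  rewrite Rpower_Ropp in Hx; change (Rpower (A * x) sigma) with (p x) in Hx.
  specialize (Hp x).
  assert (Hi : 0 < / (1 + p x) <= / p x).
  { split; [apply Rinv_0_lt_compat; lra |]; apply Rinv_le_contravar; lra. }
  replace (K * - / (1 + p x) - 0) with (- (K * / (1 + p x))) by ring.
  rewrite Rabs_Ropp, Rabs_pos_eq by (apply Rmult_le_pos; lra).
  apply Rlt_div_r in Hx; [| lra]; nra.
Qed.

Lemma exp_majorant_intro (s : C) (A B x y : R) :
  0 < x -> Rabs y <= B * ((1 + A * x) * exp (- (A * x))) ->
  Cmod (Rcpow x (s - 1) * RtoC y) <= B * exp_majorant (Re s) A x.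
Proof.
intros Hx H; rewrite Cmod_mult, Cmod_Rcpow, Cmod_R; unfold exp_majorant.
replace (Re (s - 1)) with (Re s - 1) by (destruct s; simpl; ring).
assert (Hp : 0 < Rpower x (Re s - 1)) by apply exp_pos.
apply Rmult_le_compat_l with (r := Rpower x (Re s - 1)) in H; lra.
Qed.

Lemma Gamma_correct (s : C) : 0 < Re s ->
  is_CRInt_pos (fun x => Rcpow x (s - 1) * RtoC (exp (- x)))%C (Gamma s).
Proof.
intros Hs; destruct (mellin_dominated (Re s) Hs) as [D [_ H]].
destruct (H 1 1 (fun x => Rcpow x (s - 1) * RtoC (exp (- x)))%C) as [l [Hl _]]; try lra.
- intros x Hx; apply Ccontinuous_mult; [now apply Ccontinuous_Rcpow |].
  apply Ccontinuous_RtoC; auto_derive; auto.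
- intros x Hx; apply exp_majorant_intro; [exact Hx |].
  assert (He := exp_pos (- x)); rewrite Rabs_pos_eq, !Rmult_1_l by lra; nra.
- replace (Gamma s) with l; [exact Hl |].
  symmetry; exact (is_RInt_gen_unique (V := C_R_CompleteNormedModule) _ _ Hl).
Qed.

Lemma Rcpow_opp_mult (b : R) (z : C) : (Rcpow b (- z) * Rcpow b z)%C = 1.
Proof.
rewrite <- Rcpow_add; replace (- z + z)%C with (RtoC 0) by ring.
rewrite Rcpow_cexp, Cmult_0_l; apply cexp_0.
Qed.

Lemma Rcpow_mult_base (x y : R) (z : C) : 0 < x -> 0 < y ->
  Rcpow (x * y) z = (Rcpow x z * Rcpow y z)%C.
Proof.
intros Hx Hy; rewrite !Rcpow_cexp, <- cexp_add, ln_mult, RtoC_plus by auto.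
f_equal; ring.
Qed.

(** The change of variables [x -> b x] in Euler's integral. *)
Lemma mellin_exp (s : C) (b : R) : 0 < Re s -> 0 < b ->
  is_CRInt_pos (fun x => Rcpow x (s - 1) * RtoC (exp (- (b * x))))%C
    (Gamma s * Rcpow b (- s))%C.
Proof.
intros Hs Hb.
assert (H := is_CRInt_pos_scaling b _ _ Hb (Gamma_correct s Hs)).
apply (is_CRInt_pos_Cmult (Rcpow b (- s))) in H; rewrite Cmult_comm in H.
revert H; apply (is_RInt_pos_ext (V := C_R_NormedModule)); intros x Hx.
rewrite Rcpow_mult_base by auto; at_C.
assert (E : (Rcpow b (- s) * (b * Rcpow b (s - 1)))%C = 1).
{ rewrite <- (Rcpow_1 b Hb); rewrite <- Rcpow_add.
  replace (1 + (s - 1))%C with s by ring; apply Rcpow_opp_mult. }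
transitivity ((Rcpow b (- s) * (b * Rcpow b (s - 1))) *
  (Rcpow x (s - 1) * RtoC (exp (- (b * x)))))%C; [ring |].
rewrite E; ring.
Qed.

Lemma is_Cderive_Rcpow_exp (s : C) (b x : R) : 0 < x ->
  is_Cderive (fun x => Rcpow x s * RtoC (exp (- (b * x))))%C x
    (Rcpow x (s - 1) * ((s - RtoC (b * x)) * RtoC (exp (- (b * x)))))%C.
Proof.
intros Hx.
apply (is_derive_ext (V := C_R_NormedModule)
  (fun x => (exp (Re s * ln x) * cos (Im s * ln x) * exp (- (b * x)),
             exp (Re s * ln x) * sin (Im s * ln x) * exp (- (b * x))))).
{ intros t; unfold Rcpow; apply injective_projections; simpl; ring. }
replace (Cmult _ _) with
  (exp (Re s * ln x) / x * exp (- (b * x)) *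
     ((Re s - b * x) * cos (Im s * ln x) - Im s * sin (Im s * ln x)),
   exp (Re s * ln x) / x * exp (- (b * x)) *
     ((Re s - b * x) * sin (Im s * ln x) + Im s * cos (Im s * ln x))).
- apply is_Cderive_pair; auto_derive; auto; field; lra.
- assert (E : exp (Re s * ln x) / x = exp (Re (s - 1) * ln x)).
  { rewrite <- (exp_ln x) at 2 by exact Hx; unfold Rdiv.
    rewrite <- exp_Ropp, <- exp_plus; f_equal; destruct s; simpl; ring. }
  assert (Ei : Im (s - 1) = Im s) by (destruct s; simpl; ring).
  unfold Rcpow; rewrite E, Ei; destruct s as [u v].
  apply injective_projections; simpl; ring.
Qed.

(** Integration by parts: the integrand differs from [(s - 1) x^(s-1) e^(-bx)]
    by the derivative of [- x^s e^(-bx)], which vanishes at both ends. *)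
Lemma mellin_linear_exp (s : C) (b : R) : 0 < Re s -> 0 < b ->
  is_CRInt_pos (fun x => Rcpow x (s - 1) * RtoC ((b * x - 1) * exp (- (b * x))))%C
    ((s - 1) * (Gamma s * Rcpow b (- s)))%C.
Proof.
intros Hs Hb.
assert (Hd : is_CRInt_pos
  (fun x => Rcpow x (s - 1) * ((s - RtoC (b * x)) * RtoC (exp (- (b * x)))))%C (0 - 0)%C).
{ apply (is_RInt_pos_derive (V := C_R_CompleteNormedModule)
    (fun x => Rcpow x s * RtoC (exp (- (b * x))))%C _ (RtoC 0) (RtoC 0)).
  - intros x Hx; now apply is_Cderive_Rcpow_exp.
  - intros x Hx; apply Ccontinuous_mult; [now apply Ccontinuous_Rcpow |].
    apply Ccontinuous_mult; [| apply Ccontinuous_RtoC; auto_derive; auto].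
    apply (continuous_minus (V := C_R_NormedModule)); [apply continuous_const |].
    apply Ccontinuous_RtoC; auto_derive; auto.
  - apply (filterlim_C_intro _); intros eps He.
    apply (at_right_0_intro _ (exp (ln eps / Re s))); [apply exp_pos |].
    intros x Hx.
    assert (H := Rpower_lt_near_0 (Re s) eps x Hs He Hx).
    replace (Rcpow x s * RtoC (exp (- (b * x))) - 0)%C
      with (Rcpow x s * RtoC (exp (- (b * x))))%C by ring.
    rewrite Cmod_mult, Cmod_Rcpow, Cmod_R, Rabs_pos_eq by apply Rlt_le, exp_pos.
    assert (He1 : exp (- (b * x)) <= 1).
    { rewrite <- exp_0; apply Rlt_le, exp_increasing.
      assert (0 < b * x) by (apply Rmult_lt_0_compat; lra); lra. }
    assert (Hp : 0 < Rpower x (Re s)) by apply exp_pos; nra.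
  - apply (filterlim_C_intro _); intros eps He.
    set (M := Rpower ((Re s + 1) / b) (Re s + 1)).
    assert (HM : 0 < M) by apply exp_pos.
    exists (M / eps); intros x Hx.
    assert (Hx0 : 0 < x) by (eapply Rlt_trans; [| exact Hx]; now apply Rdiv_lt_0_compat).
    replace (Rcpow x s * RtoC (exp (- (b * x))) - 0)%C
      with (Rcpow x s * RtoC (exp (- (b * x))))%C by ring.
    rewrite Cmod_mult, Cmod_Rcpow, Cmod_R, Rabs_pos_eq by apply Rlt_le, exp_pos.
    assert (H := Rpower_le_exp (Re s + 1) b x ltac:(lra) Hb Hx0); fold M in H.
    rewrite Rpower_plus, Rpower_1 in H by exact Hx0.
    apply Rlt_div_l in Hx; [| exact He].
    assert (Hee : exp (b * x) * exp (- (b * x)) = 1)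
      by (rewrite <- exp_plus, Rplus_opp_r; apply exp_0).
    assert (Hep := exp_pos (- (b * x))).
    apply Rmult_le_compat_r with (r := exp (- (b * x))) in H; [| lra].
    rewrite Rmult_assoc, (Rmult_assoc M), Hee in H.
    apply Rmult_lt_reg_r with x; [exact Hx0 |]; lra. }
assert (H := mellin_exp s b Hs Hb).
apply (is_CRInt_pos_Cmult (s - 1)) in H.
apply (is_CRInt_pos_Cmult (- (1))) in Hd.
assert (Hsum := is_CRInt_pos_plus _ _ _ _ H Hd).
replace ((s - 1) * (Gamma s * Rcpow b (- s)) + - (1) * (0 - 0))%C
  with ((s - 1) * (Gamma s * Rcpow b (- s)))%C in Hsum by ring.
revert Hsum; apply (is_RInt_pos_ext (V := C_R_NormedModule)); intros x _.
rewrite (RtoC_mult (b * x - 1)), (RtoC_minus (b * x)); at_C; ring.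
Qed.

(** * The density [h a] *)

(** One term of the geometric series for [1 / (1 - exp (- x))], multiplied by
    [x exp (- a x)] and differentiated, up to the sign. *)
Lemma h_shift (a x : R) : 0 < x ->
  h a x = (a * x - 1) * exp (- (a * x)) + h (a + 1) x.
Proof.
intros Hx; unfold h.
assert (He : exp (- x) < 1) by (rewrite <- exp_0; apply exp_increasing; lra).
replace (- (a + 1) * x) with (- a * x + - x) by ring; rewrite exp_plus.
replace (- (a * x)) with (- a * x) by ring.
field; lra.
Qed.

(** The second quotient is the derivative of [x / (1 - exp (- x))]; all four
    bounds come from [1 + t <= exp t] at [t = x] and [t = - x]. *)
Lemma bose_factor_bounds (x : R) : 0 < x ->
  0 <= x / (1 - exp (- x)) - 1 <= x /\
  0 <= (1 - exp (- x) - x * exp (- x)) / (1 - exp (- x)) ^ 2 <= 1.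
Proof.
intros Hx; set (e := exp (- x)).
assert (He0 : 0 < e) by apply exp_pos.
assert (He1 : e < 1) by (unfold e; rewrite <- exp_0; apply exp_increasing; lra).
assert (H1 : 1 - x <= e) by (assert (H := exp_ineq1_le (- x)); unfold e; lra).
assert (H2 : (1 + x) * e <= 1).
{ assert (H := exp_ineq1_le x).
  replace 1 with (exp x * e) at 2
    by (unfold e; rewrite <- exp_plus, Rplus_opp_r; apply exp_0).
  apply Rmult_le_compat_r; lra. }
assert (Hq : 0 < (1 - e) ^ 2) by (apply pow_lt; lra).
split; split.
- assert (1 <= x / (1 - e)); [| lra].
  apply (proj1 (Rle_div_r _ _ (1 - e) ltac:(lra))); lra.
- assert (x / (1 - e) <= 1 + x); [| lra].
  apply (proj2 (Rle_div_l _ _ (1 - e) ltac:(lra))); nra.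
- apply Rmult_le_pos; [lra | apply Rlt_le, Rinv_0_lt_compat, Hq].
- apply (proj2 (Rle_div_l _ _ _ Hq)); nra.
Qed.

(** The product rule for [x / (1 - exp (- x))] times [exp (- a x)], of which
    [h a] is minus the derivative. *)
Lemma h_eq (a x : R) : 0 < x ->
  h a x = exp (- (a * x)) * (a * (x / (1 - exp (- x))) -
    (1 - exp (- x) - x * exp (- x)) / (1 - exp (- x)) ^ 2).
Proof.
intros Hx; unfold h.
assert (He : exp (- x) < 1) by (rewrite <- exp_0; apply exp_increasing; lra).
replace (- (a * x)) with (- a * x) by ring.
field; lra.
Qed.

Lemma h_ge_0 (a x : R) : 1 <= a -> 0 < x -> 0 <= h a x.
Proof.
intros Ha Hx; rewrite h_eq by exact Hx.
destruct (bose_factor_bounds x Hx) as [H1 H2].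
apply Rmult_le_pos; [apply Rlt_le, exp_pos |].
assert (1 * 1 <= a * (x / (1 - exp (- x)))) by (apply Rmult_le_compat; lra).
lra.
Qed.

Lemma h_minus_exp_bound (a x : R) : 0 < a -> 0 < x ->
  Rabs (h a x - a * exp (- (a * x))) <= (1 + a * x) * exp (- (a * x)).
Proof.
intros Ha Hx; rewrite h_eq by exact Hx.
destruct (bose_factor_bounds x Hx) as [H1 H2].
set (q := _ / _ ^ 2) in *; set (t := x / _) in *.
assert (He := exp_pos (- (a * x))); set (E := exp (- (a * x))) in *.
replace (E * (a * t - q) - a * E) with (E * (a * (t - 1) - q)) by ring.
rewrite Rabs_mult, (Rabs_pos_eq E), Rmult_comm by lra.
apply Rmult_le_compat_r; [lra |].
assert (H3 : 0 <= a * (t - 1)) by (apply Rmult_le_pos; lra).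
assert (H4 : a * (t - 1) <= a * x) by (apply Rmult_le_compat_l; lra).
apply Rabs_le; lra.
Qed.

Lemma ex_derive_h (a x : R) : 0 < x -> ex_derive (h a) x.
Proof.
intros Hx; unfold h; auto_derive.
assert (He : exp (- x) < 1) by (rewrite <- exp_0; apply exp_increasing; lra).
rewrite Rmult_1_r; apply Rgt_not_eq, Rmult_lt_0_compat; lra.
Qed.

Lemma h_density (a : R) : 1 <= a -> is_density_pos (h a).
Proof.
intros Ha; split; [intros x Hx; now apply h_ge_0 |].
set (u := fun x => - (x * exp (- (a * x)) / (1 - exp (- x)))).
assert (Hu : forall x, 0 < x -> exp (- (a * x)) <= - u x <= (1 + x) * exp (- (a * x))).
{ intros x Hx; destruct (bose_factor_bounds x Hx) as [H1 _].
  assert (He := exp_pos (- (a * x))).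
  replace (- u x) with (x / (1 - exp (- x)) * exp (- (a * x))) by (unfold u, Rdiv; ring).
  split; [rewrite <- (Rmult_1_l (exp _)) at 1 |]; apply Rmult_le_compat_r; lra. }
replace 1 with (minus 0 (- (1))) by (unfold minus, plus, opp; simpl; ring).
apply (is_RInt_pos_derive (V := R_CompleteNormedModule) u).
- intros x Hx; rewrite h_eq by exact Hx; unfold u.
  assert (He : exp (- x) < 1) by (rewrite <- exp_0; apply exp_increasing; lra).
  auto_derive; [lra |]; field; lra.
- intros x Hx; apply (ex_derive_continuous (K := R_AbsRing) (V := R_NormedModule)).
  now apply ex_derive_h.
- apply (filterlim_R_intro _); intros eps He.
  apply (at_right_0_intro _ (eps / (a + 1))); [apply Rdiv_lt_0_compat; lra |].
  intros x [Hx0 Hx]; destruct (Hu x Hx0) as [H1 H2].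
  apply Rlt_div_r in Hx; [| lra].
  assert (Hax : 0 < a * x) by (apply Rmult_lt_0_compat; lra).
  assert (H3 : 1 - a * x <= exp (- (a * x)))
    by (assert (H := exp_ineq1_le (- (a * x))); lra).
  assert (H4 : exp (- (a * x)) <= 1)
    by (rewrite <- exp_0; apply Rlt_le, exp_increasing; lra).
  assert (H5 : (1 + x) * exp (- (a * x)) <= (1 + x) * 1) by (apply Rmult_le_compat_l; lra).
  apply Rabs_def1; lra.
- apply (filterlim_R_intro _); intros eps He.
  exists (4 / eps); intros x Hx.
  assert (Hx0 : 0 < x) by (eapply Rlt_trans; [| exact Hx]; apply Rdiv_lt_0_compat; lra).
  destruct (Hu x Hx0) as [H1 H2]; assert (H0 := exp_pos (- (a * x))).
  apply Rlt_div_l in Hx; [| exact He].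
  assert (H3 : exp (- (a * x)) <= exp (- x)).
  { destruct (Rle_lt_or_eq_dec 1 a Ha) as [H | <-]; [| rewrite Rmult_1_l; lra].
    apply Rlt_le, exp_increasing; nra. }
  (* [exp (- x) (1 + x / 2)^2 <= 1] *)
  assert (H4 : (1 + x) * exp (- x) * x <= 4).
  { assert (H := exp_ineq1_le (x / 2)).
    assert (Hee : exp (x / 2) * exp (x / 2) * exp (- x) = 1).
    { rewrite <- !exp_plus; replace (x / 2 + x / 2 + - x) with 0 by field; apply exp_0. }
    assert (Hsq : (1 + x) * x <= 4 * (exp (x / 2) * exp (x / 2))).
    { apply Rle_trans with (4 * ((1 + x / 2) * (1 + x / 2))); [nra |].
      apply Rmult_le_compat_l; [lra |]; apply Rmult_le_compat; lra. }
    apply Rmult_le_compat_r with (r := exp (- x)) in Hsq; [| apply Rlt_le, exp_pos].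
    lra. }
  assert (H5 : (1 + x) * exp (- (a * x)) <= (1 + x) * exp (- x))
    by (apply Rmult_le_compat_l; lra).
  assert (H6 : (1 + x) * exp (- x) < eps) by (apply Rmult_lt_reg_r with x; lra).
  apply Rabs_def1; lra.
Qed.

(** * The Mellin transform of [h a] *)

Lemma Ccontinuous_Rcpow_mult (z : C) (f : R -> R) (x : R) : 0 < x -> ex_derive f x ->
  Ccontinuous (fun x => Rcpow x z * RtoC (f x))%C x.
Proof.
intros Hx Hf; apply Ccontinuous_mult; [now apply Ccontinuous_Rcpow |].
now apply Ccontinuous_RtoC.
Qed.

(** The main term is the Mellin transform of [b exp (- b x)]. *)
Lemma mellin_h_approx (s : C) : 0 < Re s ->
  exists D, 0 < D /\ forall b, 0 < b ->
    exists e : C, is_CRInt_pos (fun x => Rcpow x (s - 1) * RtoC (h b x))%C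
      (Gamma s * Rcpow b (1 - s) + e)%C /\ Cmod e <= D * Rpower b (- Re s).
Proof.
intros Hs; destruct (mellin_dominated (Re s) Hs) as [D [HD H]].
exists D; split; [exact HD |]; intros b Hb.
destruct (H b 1 (fun x => Rcpow x (s - 1) * RtoC (h b x - b * exp (- (b * x))))%C)
  as [e [He Hle]]; try lra.
- intros x Hx; apply (Ccontinuous_Rcpow_mult _ (fun x => h b x - b * exp (- (b * x)))); auto.
  apply (ex_derive_minus (K := R_AbsRing) (V := R_NormedModule)); [now apply ex_derive_h |].
  auto_derive; auto.
- intros x Hx; apply exp_majorant_intro; [exact Hx |].
  rewrite Rmult_1_l; now apply h_minus_exp_bound.
- exists e; split; [| lra].
  assert (Hg := is_CRInt_pos_plus _ _ _ _
    (is_CRInt_pos_Cmult (RtoC b) _ _ (mellin_exp s b Hs Hb)) He).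
  replace (RtoC b * (Gamma s * Rcpow b (- s)))%C with (Gamma s * Rcpow b (1 - s))%C in Hg.
  + revert Hg; apply (is_RInt_pos_ext (V := C_R_NormedModule)); intros x _.
    rewrite RtoC_minus, (RtoC_mult b); at_C; ring.
  + replace (1 - s)%C with (1 + - s)%C by ring; rewrite Rcpow_add, Rcpow_1 by exact Hb; ring.
Qed.

Lemma mellin_h_iter (a : R) (s l : C) (n : nat) : 1 <= a -> 0 < Re s ->
  is_CRInt_pos (fun x => Rcpow x (s - 1) * RtoC (h (INR (S n) + a) x))%C l ->
  is_CRInt_pos (fun x => Rcpow x (s - 1) * RtoC (h a x))%C
    ((s - 1) * Gamma s * Csum (fun n => Rcpow (INR n + a) (- s)) n + l)%C.
Proof.
intros Ha Hs.
assert (Hstep : forall b l, 0 < b ->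
  is_CRInt_pos (fun x => Rcpow x (s - 1) * RtoC (h (b + 1) x))%C l ->
  is_CRInt_pos (fun x => Rcpow x (s - 1) * RtoC (h b x))%C
    ((s - 1) * (Gamma s * Rcpow b (- s)) + l)%C).
{ intros b l' Hb H.
  assert (Hg := is_CRInt_pos_plus _ _ _ _ (mellin_linear_exp s b Hs Hb) H).
  revert Hg; apply (is_RInt_pos_ext (V := C_R_NormedModule)); intros x Hx.
  rewrite (h_shift b x Hx), RtoC_plus; at_C; ring. }
revert l; induction n as [| n IH]; intros l H.
- rewrite sum_O; simpl INR in *; rewrite Rplus_0_l; rewrite (Rplus_comm 1) in H.
  apply Hstep in H; [| lra].
  now replace ((s - 1) * Gamma s * Rcpow a (- s) + l)%C with
    ((s - 1) * (Gamma s * Rcpow a (- s)) + l)%C by ring.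
- rewrite S_INR in H; replace (INR (S n) + 1 + a) with (INR (S n) + a + 1) in H by ring.
  apply Hstep in H; [| assert (Hn := pos_INR (S n)); lra].
  apply IH in H; rewrite sum_Sn.
  set (S0 := Csum _ n) in *.
  change (plus S0 (Rcpow (INR (S n) + a) (- s))) with (S0 + Rcpow (INR (S n) + a) (- s))%C.
  now replace ((s - 1) * Gamma s * (S0 + Rcpow (INR (S n) + a) (- s)) + l)%C with
    ((s - 1) * Gamma s * S0 + ((s - 1) * (Gamma s * Rcpow (INR (S n) + a) (- s)) + l))%C by ring.
Qed.

(** The Mellin transform, including [s = 1]: the partial sums of
    [(s - 1) zeta(s, a)] times [Gamma s] differ from it by the error made on
    [h (N + a)], which is [O (N^(- Re s))]. *)
Lemma mellin_h (a : R) (s : C) : 1 <= a -> 0 < Re s ->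
  is_CRInt_pos (fun x => Rcpow x (s - 1) * RtoC (h a x))%C (Gamma s * zeta_reg a s)%C.
Proof.
intros Ha Hs.
destruct (mellin_h_approx s Hs) as [D [HD Happ]].
assert (Hn : forall n, exists e : C,
  is_CRInt_pos (fun x => Rcpow x (s - 1) * RtoC (h a x))%C
    (Gamma s * (Csum (fun n => zeta_term (INR n + a) s) n + Rcpow a (1 - s)) + e)%C /\
  Cmod e <= D * Rpower (INR (S n) + a) (- Re s)).
{ intros n; destruct (Happ (INR (S n) + a)) as [e [He Hle]].
  { assert (H := pos_INR (S n)); lra. }
  exists e; split; [| exact Hle].
  apply (mellin_h_iter a s _ n Ha Hs) in He; rewrite zeta_term_partial_sum.
  set (S0 := Csum _ n) in *.
  match type of He with is_CRInt_pos _ ?v => match goal with |- is_CRInt_pos _ ?w =>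
    replace w with v by ring; exact He end end. }
destruct (Hn 0%nat) as [e0 [H0 _]]; set (l := (_ + e0)%C) in H0.
enough (E : (l - Gamma s * zeta_reg a s = 0)%C).
{ replace (Gamma s * zeta_reg a s)%C with (l - (l - Gamma s * zeta_reg a s))%C by ring.
  rewrite E; now replace (l - 0)%C with l by ring. }
apply Cmod_le_0; intros eps He.
assert (HG : 0 <= Cmod (Gamma s)) by apply Cmod_ge_0.
assert (He1 : 0 < eps / 2 / (Cmod (Gamma s) + 1)) by (apply Rdiv_lt_0_compat; lra).
assert (He2 : 0 < eps / 2 / D) by (apply Rdiv_lt_0_compat; lra).
assert (Hz := zeta_term_sum_correct a s Ha Hs); rewrite is_Cseries_iff in Hz.
destruct (Hz _ He1) as [N HN].
destruct (Rpower_neg_to_0 a (Re s) _ ltac:(lra) Hs He2) as [N' HN'].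
set (n := max N N').
specialize (HN n ltac:(lia)); specialize (HN' (S n) ltac:(lia)).
destruct (Hn n) as [e [Hl Hle]].
rewrite (is_CRInt_pos_inj _ _ _ H0 Hl); unfold zeta_reg.
set (S0 := Csum _ n) in *.
replace (Gamma s * (S0 + Rcpow a (1 - s)) + e - Gamma s * (Rcpow a (1 - s) + zeta_term_sum a s))%C
  with (Gamma s * (S0 - zeta_term_sum a s) + e)%C by ring.
eapply Rle_trans; [apply Cmod_triangle |]; rewrite Cmod_mult.
apply Rlt_div_r in HN; [| lra].
apply Rlt_div_r in HN'; [| exact HD].
assert (H := Cmod_ge_0 (S0 - zeta_term_sum a s)); nra.
Qed.

(** From [|x^w - 1| <= |w ln x| exp |w ln x|] and, at [t = |ln x|],
    [t exp (t / 4) <= 4 exp (t / 2)] with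
    [exp (t / 2) <= x^(-1/2) + x^(1/2)]. *)
Lemma Rcpow_minus_1_bound (x : R) (w : C) : 0 < x -> Cmod w <= / 4 ->
  Cmod (Rcpow x w - 1) <= 4 * Cmod w * (Rpower x (- / 2) * (1 + x)).
Proof.
intros Hx Hw; rewrite Rcpow_cexp.
assert (H := cexp_taylor (w * RtoC (ln x)) 1 1 ltac:(lra)).
replace (exp_partial (w * RtoC (ln x)) 1 1) with (RtoC 1) in H.
2: { apply injective_projections; simpl; field. }
rewrite Cmult_1_l, Rmult_1_r in H; eapply Rle_trans; [exact H |].
rewrite Cmod_mult, Cmod_R; simpl; unfold Rdiv; rewrite Rinv_1, !Rmult_1_r.
set (t := Rabs (ln x)); assert (Ht : 0 <= t) by apply Rabs_pos.
assert (Hc := Cmod_ge_0 w).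
assert (H1 : exp (Cmod w * t) <= exp (t / 4)).
{ destruct (Rle_lt_or_eq_dec (Cmod w * t) (t / 4)) as [H1 | ->]; [nra | | lra].
  now apply Rlt_le, exp_increasing. }
assert (H2 : t <= 4 * exp (t / 4)) by (assert (H2 := exp_ineq1_le (t / 4)); lra).
assert (H3 : exp (t / 4) * exp (t / 4) = exp (t / 2))
  by (rewrite <- exp_plus; f_equal; field).
assert (H4 : exp (t / 2) <= Rpower x (- / 2) * (1 + x)).
{ rewrite Rmult_plus_distr_l, Rmult_1_r.
  replace (Rpower x (- / 2) * x) with (Rpower x (- / 2 + 1))
    by (rewrite Rpower_plus, Rpower_1 by exact Hx; reflexivity).
  unfold Rpower.
  assert (P1 := exp_pos (- / 2 * ln x)); assert (P2 := exp_pos ((- / 2 + 1) * ln x)).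
  unfold t, Rabs; destruct (Rcase_abs (ln x)).
  - replace (- ln x / 2) with (- / 2 * ln x) by field; lra.
  - replace (ln x / 2) with ((- / 2 + 1) * ln x) by field; lra. }
assert (H5 := exp_pos (t / 4)).
apply Rle_trans with (exp (t / 4) * (Cmod w * (4 * exp (t / 4)))).
- apply Rmult_le_compat; [apply Rlt_le, exp_pos | now apply Rmult_le_pos | exact H1 |].
  now apply Rmult_le_compat_l.
- replace (exp (t / 4) * (Cmod w * (4 * exp (t / 4)))) with (4 * Cmod w * exp (t / 2))
    by (rewrite <- H3; ring).
  apply Rmult_le_compat_l; lra.
Qed.

Lemma h_le (a x : R) : 1 <= a -> 0 < x ->
  h a x <= (1 + a) * ((1 + a * x) * exp (- (a * x))).
Proof.
intros Ha Hx.
assert (H := h_minus_exp_bound a x ltac:(lra) Hx).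
apply Rabs_le_between in H; destruct H as [_ H].
assert (Hax : 0 < a * x) by (apply Rmult_lt_0_compat; lra).
assert (He := exp_pos (- (a * x))).
assert (a * exp (- (a * x)) <= a * ((1 + a * x) * exp (- (a * x))))
  by (apply Rmult_le_compat_l; nra).
lra.
Qed.

(** The difference of the two transforms is the integral of
    [(x^(z-1) - 1) h_a(x)].  The bound of the first factor costs a factor
    [1 + x], which is paid for by halving the rate of the exponential. *)
Lemma mellin_h_lipschitz_at_1 (a : R) : 1 <= a ->
  exists D, 0 < D /\ forall z, Cmod (z - 1) <= / 4 ->
    Cmod (Gamma z * zeta_reg a z - Gamma 1 * zeta_reg a 1) <= Cmod (z - 1) * D.
Proof.
intros Ha; destruct (mellin_dominated (/ 2) ltac:(lra)) as [D [HD H]].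
set (D' := 16 * (1 + a) * (D * Rpower (a / 2) (- / 2))).
assert (HD' : 0 < D').
{ apply Rmult_lt_0_compat; [lra |]; apply Rmult_lt_0_compat; [exact HD | apply exp_pos]. }
exists D'; split; [exact HD' |]; intros z Hz.
assert (Hrz : 0 < Re z).
{ assert (Hr := re_le_Cmod (z - 1)); apply Rabs_le_between in Hr.
  destruct z; simpl in *; lra. }
assert (Hc := Cmod_ge_0 (z - 1)).
destruct (H (a / 2) (Cmod (z - 1) * (16 * (1 + a)))
  (fun x => (Rcpow x (z - 1) - Rcpow x (1 - 1)) * RtoC (h a x))%C) as [l [Hl Hle]].
- lra.
- apply Rmult_le_pos; lra.
- intros x Hx; apply Ccontinuous_mult; [| now apply Ccontinuous_RtoC, ex_derive_h].
  apply (continuous_minus (V := C_R_NormedModule)); now apply Ccontinuous_Rcpow.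
- intros x Hx.
  replace (Rcpow x (1 - 1)) with (RtoC 1).
  2: { replace (1 - 1)%C with (RtoC 0) by ring; rewrite Rcpow_cexp, Cmult_0_l.
       symmetry; apply cexp_0. }
  rewrite Cmod_mult, Cmod_R, Rabs_pos_eq by now apply h_ge_0.
  assert (H1 := Rcpow_minus_1_bound x (z - 1) Hx Hz).
  assert (H2 := h_le a x Ha Hx); assert (H3 := h_ge_0 a x Ha Hx).
  unfold exp_majorant.
  replace (/ 2 - 1) with (- / 2) by field.
  set (p := Rpower x (- / 2)) in *; assert (Hp : 0 < p) by apply exp_pos.
  assert (H4 : (1 + x) * ((1 + a * x) * exp (- (a * x))) <=
               4 * ((1 + a / 2 * x) * exp (- (a / 2 * x)))).
  { assert (Hax : x <= a * x) by nra.
    set (y := a / 2 * x); replace (a * x) with (2 * y) in * by (unfold y; field).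
    assert (Hy := exp_ineq1_le y).
    assert (Hee : exp (- (2 * y)) * exp y = exp (- y))
      by (rewrite <- exp_plus; f_equal; ring).
    assert (He := exp_pos (- (2 * y))).
    apply Rle_trans with (4 * ((1 + y) * (exp (- (2 * y)) * exp y))); [| rewrite Hee; lra].
    assert (Hq : (1 + x) * (1 + 2 * y) <= 4 * ((1 + y) * exp y)).
    { apply Rle_trans with ((2 * (1 + y)) * (2 * exp y)); [| lra].
      apply Rmult_le_compat; lra. }
    apply Rmult_le_compat_r with (r := exp (- (2 * y))) in Hq; lra. }
  apply Rle_trans with (4 * Cmod (z - 1) * (p * (1 + x)) *
    ((1 + a) * ((1 + a * x) * exp (- (a * x))))).
  + apply Rmult_le_compat; auto using Cmod_ge_0.
  + apply Rmult_le_compat_l with (r := 4 * Cmod (z - 1) * (1 + a) * p) in H4; [lra |].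
    repeat apply Rmult_le_pos; lra.
- assert (Hd := is_CRInt_pos_plus _ _ _ _ Hl (mellin_h a 1 Ha ltac:(simpl; lra))).
  assert (E : (Gamma z * zeta_reg a z)%C = (l + Gamma 1 * zeta_reg a 1)%C).
  { apply (is_CRInt_pos_inj _ _ _ (mellin_h a z Ha Hrz)).
    revert Hd; apply (is_RInt_pos_ext (V := C_R_NormedModule)); intros x _; at_C; ring. }
  rewrite E; replace (l + Gamma 1 * zeta_reg a 1 - Gamma 1 * zeta_reg a 1)%C with l by ring.
  unfold D'; lra.
Qed.

Theorem corollary2p3 (a : R) (ha : 1 <= a) :
  is_density_pos (h a) /\
  forall s : C, 0 < Re s ->
    exists w : C,
      is_value_ext
        (fun z : C => ((z - 1) * Gamma z * hurwitz_zeta z a)%C) (RtoC 1) s w /\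
      is_RInt_pos (V := C_R_NormedModule)
        (fun x : R => (Rcpow x (s - 1) * h a x)%C) w.
Proof.
split; [now apply h_density |]; intros s Hs.
assert (Heq : forall z, 0 < Re z -> z <> RtoC 1 ->
  ((z - 1) * Gamma z * hurwitz_zeta z a)%C = (Gamma z * zeta_reg a z)%C).
{ intros z Hz Hz1; rewrite hurwitz_zeta_eq by auto; field.
  intros E; apply Hz1; replace z with (z - 1 + 1)%C by ring; rewrite E; ring. }
exists (Gamma s * zeta_reg a s)%C; split; [| now apply mellin_h].
split; [intros Hs1; symmetry; now apply Heq |].
intros ->; destruct (mellin_h_lipschitz_at_1 a ha) as [D [HD HL]].
apply filterlim_C_intro; [apply within_filter, locally_filter |].
intros eps He.
assert (Hd : 0 < Rmin (/ 4) (eps / D) / 2).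
{ apply Rdiv_lt_0_compat; [| lra]; apply Rmin_pos; [lra | now apply Rdiv_lt_0_compat]. }
exists (mkposreal _ Hd); intros z Hball Hz1.
assert (Hz : Cmod (z - 1) < Rmin (/ 4) (eps / D)).
{ assert (H := C_NormedModule_mixin_compat2 (RtoC 1) z (mkposreal _ Hd) Hball).
  simpl pos in H; change (minus z (RtoC 1)) with (z - 1)%C in H.
  assert (Hsq : sqrt 2 < 2) by (rewrite <- (sqrt_square 2) at 2 by lra; apply sqrt_lt_1; lra).
  nra. }
assert (H1 := Rlt_le_trans _ _ _ Hz (Rmin_l _ _)).
assert (H2 := Rlt_le_trans _ _ _ Hz (Rmin_r _ _)).
rewrite Heq; [| | exact Hz1].
- eapply Rle_lt_trans; [apply HL; lra |].
  now apply Rlt_div_r in H2.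
- assert (Hr := re_le_Cmod (z - 1)); apply Rabs_le_between in Hr.
  destruct z; simpl in *; lra.
Qed.
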